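(* Let $(\Omega,\mathcal{M},\mu)$ and $(\Xi,\mathcal{M}',\nu)$ be $\sigma$-finite complete measure spaces, let $p(\cdot)\in\mathcal{P}(\Omega,\mu)$ and $q(\cdot)\in\mathcal{P}(\Xi,\nu)$, and let $p'(\cdot)$ be the conjugate exponent of $p(\cdot)$. Let $0<r\le 1$. Then $T$ is an $r$-nuclear operator from $L^{p(\cdot)}(\mu)$ into $L^{q(\cdot)}(\nu)$ if and only if there exist a sequence $(g_n)$ in $L^{q(\cdot)}(\nu)$ and a sequence $(h_n)$ in $L^{p'(\cdot)}(\mu)$ such that $$\sum_{n=1}^\infty \|g_n\|_{L^{q(\cdot)}(\nu)}^r\,\|h_n\|_{L^{p'(\cdot)}(\mu)}^r<\infty,$$ and such that for all $f\in L^{p(\cdot)}(\mu)$ we have $$Tf(x)=\int_\Omega\Big(\sum_{n=1}^\infty g_n(x)h_n(y)\Big)f(y)\,d\mu(y)\quad\text{for a.e. }x.$$ Moreover, if $\Omega=\Xi$, $\mu=\nu$, $p(\cdot)=q(\cdot)$, $p^+<\infty$, and $T\in\mathcal{L}(L^{p(\cdot)}(\mu))$ is $r$-nuclear, then, with $(g_n)$ in $L^{p(\cdot)}(\mu)$ and $(h_n)$ in $L^{p'(\cdot)}(\mu)$ sequences representing $T$ in the sense that $\sum_{n=1}^\infty \|g_n\|_{L^{p(\cdot)}(\mu)}^r\,\|h_n\|_{L^{p'(\cdot)}(\mu)}^r<\infty$ and, for all $f\in L^{p(\cdot)}(\mu)$, $Tf(x)=\int_\Omega\big(\sum_{n=1}^\infty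 g_n(x)h_n(y)\big)f(y)\,d\mu(y)$ for a.e. $x$, $$\operatorname{Tr}(T)=\sum_{n=1}^\infty\langle g_n,h_n\rangle=\int_\Omega\sum_{n=1}^\infty g_n(x)h_n(x)\,d\mu(x).$$
   Context: $\mathcal{P}(\Omega,\mu)$ is the set of $\mu$-measurable functions $p:\Omega\to[1,\infty]$ (variable exponents); $p^+:=\operatorname{ess\,sup}_{\Omega}p$. For measurable $f:\Omega\to\mathbb{R}$, $\rho_{p(\cdot)}(f):=\int_\Omega|f(x)|^{p(x)}\,d\mu(x)$, with the convention $t^\infty=0$ for $0\le t\le1$ and $t^\infty=\infty$ for $t>1$; $\|f\|_{L^{p(\cdot)}(\mu)}:=\inf\{\lambda>0:\rho_{p(\cdot)}(f/\lambda)\le1\}$, and $L^{p(\cdot)}(\mu)$ is the Banach space of (a.e.-classes of) measurable $f$ with finite norm. The conjugate exponent $p'(\cdot)$ is defined pointwise by $\frac1{p(x)}+\frac1{p'(x)}=1$ (with $1/\infty=0$). The pairing between $L^{p(\cdot)}(\mu)$ and $L^{p'(\cdot)}(\mu)$ is $\langle f,h\rangle=\int_\Omega f h\,d\mu$. For Banach spaces $\mathcal{B}_1,\mathcal{B}_2$ and $0<r\le1$, a linear operator $T:\mathcal{B}_1\to\mathcal{B}_2$ is $r$-nuclear if there are sequences $(x_n')$ in $\mathcal{B}_1'$ and $(y_n)$ in $\mathcal{B}_2$ with $Tx=\sum_{n=1}^\infty\langle x,x_n'\rangle y_n$ for all $x\in\mathcal{B}_1$ (convergence in $\mathcal{B}_2$)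 and $\sum_{n=1}^\infty\|x_n'\|^r_{\mathcal{B}_1'}\|y_n\|^r_{\mathcal{B}_2}<\infty$. For $\mathcal{B}_1=L^{p(\cdot)}(\mu)$ the space $\mathcal{B}_1'$ is identified with $L^{p'(\cdot)}(\mu)$ via the pairing $\langle f,h\rangle=\int_\Omega f h\,d\mu$, in the sense of the associate space (for $p^+<\infty$ this is the Banach dual up to equivalent norms). $\mathcal{L}(\mathcal{B})$ is the algebra of bounded linear operators on $\mathcal{B}$. If $\mathcal{B}$ is a Banach space with the approximation property (for each compact $K\subset\mathcal{B}$ and $\epsilon>0$ there is a finite rank bounded operator $F$ on $\mathcal{B}$ with $\|x-Fx\|<\epsilon$ for all $x\in K$), then for a nuclear ($1$-nuclear) operator $T=\sum_n x_n'\otimes y_n$ on $\mathcal{B}$ the trace $\operatorname{Tr}(T):=\sum_{n=1}^\infty x_n'(y_n)$ does not depend on the representation. For $p^+<\infty$, $L^{p(\cdot)}(\mu)$ has the (bounded) approximation property, so $\operatorname{Tr}$ is well defined on it. *)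

(* Defs.v *)
From HB Require Import structures.
From mathcomp Require Import all_boot all_order all_algebra.
From mathcomp Require Import all_classical all_reals all_analysis.
From mathcomp Require Import measurable_realfun measurable_fun_approximation.
From mathcomp Require Import ess_sup_inf.
From mathcomp Require Import ring lra.

Set Implicit Arguments.
Unset Strict Implicit.
Unset Printing Implicit Defensive.

Import Order.TTheory GRing.Theory Num.Theory.
Import numFieldNormedType.Exports.

Local Open Scope classical_set_scope.
Local Open Scope ring_scope.

Record vexponent d (T : measurableType d) (R : realType) := VExponent {
  vexp_fun :> T -> \bar R ;
  measurable_vexp : measurable_fun [set: T] vexp_fun ;
  vexp_ge1 : forall x, (1 <= vexp_fun x)%E }.

(* [epow t s] is [t^s] for [0 <= t] and [1 <= s <= +oo], with [t^oo = 0] if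
   [t <= 1] and [t^oo = +oo] otherwise. The branch [-oo] is never used. *)
Definition epow (R : realType) (t : R) (s : \bar R) : \bar R :=
  match s with
  | r%:E => (t `^ r)%:E
  | +oo%E => if t <= 1 then 0%E else +oo%E
  | -oo%E => 0%E
  end.

Section epow.
Context {R : realType}.
Implicit Types (t u : R) (s : \bar R).
Local Open Scope ereal_scope.

Lemma epow_ge0 t s : 0 <= epow t s.
Proof.
by case: s => [r| |] //=; [rewrite lee_fin powR_ge0|case: ifP].
Qed.

Lemma epow0 s : 1 <= s -> epow 0 s = 0.
Proof.
case: s => [r| |] //=; last by rewrite ler01.
by rewrite lee_fin => r1; rewrite powR0// gt_eqF// (lt_le_trans ltr01).
Qed.

Lemma le_epow t u s : 1 <= s -> (0 <= t)%R -> (t <= u)%R ->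
  epow t s <= epow u s.
Proof.
case: s => [r| |] //= s1 t0 tu.
  rewrite lee_fin ge0_ler_powR ?nnegrE//; last exact: le_trans tu.
  by move: s1; rewrite lee_fin; apply: le_trans.
case: ifPn => [_|t1]; first by case: ifP.
by rewrite ifF//; apply/negbTE; apply: contra t1; exact: le_trans.
Qed.

Lemma epow_convex (a b t u : R) s : 1 <= s ->
  (0 < a)%R -> (0 < b)%R -> (a + b = 1)%R -> (0 <= t)%R -> (0 <= u)%R ->
  epow (a * t + b * u) s <= a%:E * epow t s + b%:E * epow u s.
Proof.
case: s => [r| |] //= s1 a0 b0 ab t0 u0.
  rewrite -!EFinM -EFinD lee_fin.
  have [a0' a1] : (0 <= a)%R /\ (a <= 1)%R by split; lra.
  rewrite (_ : b = 1 - a)%R; last by lra.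
  by apply: (@convex_powR R r s1 (@Itv01 R a a0' a1) t u);
    rewrite inE/= in_itv/= andbT.
case: ifPn => [_|h].
  by apply: adde_ge0; apply: mule_ge0; rewrite ?lee_fin ?(ltW a0) ?(ltW b0)//;
    case: ifP.
have [t1|t1] := leP t 1%R; have [u1|u1] := leP u 1%R.
- by move: h; rewrite (_ : (_ <= _)%R)//; nra.
- by rewrite mule0 add0e gt0_muley.
- by rewrite mule0 adde0 gt0_muley.
- by rewrite gt0_muley// gt0_muley.
Qed.

Lemma epow_scale (a t : R) s : 1 <= s -> (0 < a <= 1)%R -> (0 <= t)%R ->
  epow (a * t) s <= a%:E * epow t s.
Proof.
move=> s1 /andP[a0]; rewrite le_eqVlt => /predU1P[->|a1] t0.
  by rewrite mul1r mul1e.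
have b0 : (0 < 1 - a)%R by rewrite subr_gt0.
have := @epow_convex a (1 - a) t 0 s s1 a0 b0 (subrKC _ _) t0 (lexx _).
by rewrite mulr0 addr0 epow0// mule0 adde0.
Qed.

Lemma measurable_epow d (T : measurableType d) (f : T -> R) (p : T -> \bar R) :
  measurable_fun [set: T] f -> measurable_fun [set: T] p ->
  (forall x, 1 <= p x) ->
  measurable_fun [set: T] (fun x => epow (f x) (p x)).
Proof.
move=> mf mp p1.
rewrite (_ : (fun x => _) = (fun x => if p x == +oo then
    (if (f x <= 1)%R then 0 else +oo) else
    if f x == 0%R then 0 else (expR (fine (p x) * ln (f x)))%:E)); last first.
  apply/funext => x; have := p1 x; case: (p x) => //= r; rewrite lee_fin => r1.
  by rewrite /powR; case: ifP => // _; rewrite gt_eqF// (lt_le_trans ltr01).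
apply: measurable_fun_ifT; first exact: measurable_fun_eqe.
  by apply: measurable_fun_ifT => //; exact: measurable_fun_ler.
apply: measurable_fun_ifT => //; first exact: measurable_fun_eqr.
apply/measurable_EFinP; apply: measurableT_comp => //.
apply: measurable_funM; first exact: measurableT_comp.
exact: measurableT_comp.
Qed.

End epow.

Section conjugate_exponent.
Context {d} {T : measurableType d} {R : realType}.
Variable p : vexponent T R.
Local Open Scope ereal_scope.

Lemma measurable_vexp_conj :
  measurable_fun [set: T] (fun x => hoelder_conjugate (p x)).
Proof.
have mp := measurable_vexp p.
rewrite (_ : (fun x => _) = (fun x => if p x == +oo then 1 else
   if p x == 1 then +oo else (fine (p x) * (fine (p x) - 1) `^ (-1))%:E));
  last first.
  apply/funext => x; have := vexp_ge1 p x; case: (p x) => [r| |]//=.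
  rewrite lee_fin => r1; have [->|rn1] := eqVneq r%:E 1.
    by rewrite hoelder_conjugate1.
  have r1' : (1 < r)%R by rewrite lt_neqAle r1 andbT eq_sym -eqe.
  rewrite /hoelder_conjugate/= eqe gt_eqF ?(lt_trans ltr01)//.
  rewrite -EFinB inver subr_eq0 gt_eqF//.
  by rewrite powR_inv1 ?subr_ge0// EFinM.
apply: measurable_fun_ifT => //; first exact: measurable_fun_eqe.
apply: measurable_fun_ifT => //; first exact: measurable_fun_eqe.
have mfp : measurable_fun [set: T] (fun x => fine (p x)).
  exact: measurableT_comp.
apply/measurable_EFinP; apply: measurable_funM => //.
apply: (@measurableT_comp _ _ _ _ _ _ (@powR R ^~ (-1)%R)) => //.
exact: measurable_funB.
Qed.

Lemma vexp_conj_ge1 x : 1 <= hoelder_conjugate (p x).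
Proof.
have := vexp_ge1 p x; case: (p x) => [r| |]//= r1.
exact: hoelder_conj_ge1.
Qed.

Definition vexp_conj := VExponent measurable_vexp_conj vexp_conj_ge1.

End conjugate_exponent.

Section luxemburg.
Context {d} {T : measurableType d} {R : realType}.
Variables (mu : {measure set T -> \bar R}) (p : vexponent T R).
Implicit Types f g : T -> R.
Local Open Scope ereal_scope.

Definition modular f : \bar R := \int[mu]_x epow `|f x|%R (p x).

Definition lux_set f : set R :=
  [set l | (0 < l)%R /\ modular (fun x => f x / l)%R <= 1].

Definition lux_norm f : \bar R := ereal_inf (EFin @` lux_set f).

Definition vLfun : {pred T -> R} :=
  mem [set f | measurable_fun [set: T] f /\ lux_norm f < +oo].


Lemma measurable_modular f : measurable_fun [set: T] f ->
  measurable_fun [set: T] (fun x => epow `|f x|%R (p x)).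
Proof.
move=> mf; apply: measurable_epow; last exact: vexp_ge1.
  exact: measurableT_comp.
exact: measurable_vexp.
Qed.

Lemma measurable_fun_divr f (l : R) : measurable_fun [set: T] f ->
  measurable_fun [set: T] (fun x => f x / l)%R.
Proof. by move=> mf; exact: measurable_funM. Qed.

Lemma le_modular f g : measurable_fun [set: T] f -> measurable_fun [set: T] g ->
  (forall x, `|f x| <= `|g x|)%R -> modular f <= modular g.
Proof.
move=> mf mg fg; apply: ge0_le_integral => //.
- by move=> x _; exact: epow_ge0.
- exact: measurable_modular.
- exact: measurable_modular.
- by move=> x _; apply: le_epow => //; exact: vexp_ge1.
Qed.

Lemma ae_eq_modular f g : measurable_fun [set: T] f ->
  measurable_fun [set: T] g -> f = g %[ae mu] -> modular f = modular g.
Proof.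
move=> mf mg fg; apply: ge0_ae_eq_integral => //.
- exact: measurable_modular.
- exact: measurable_modular.
- by move=> x _; exact: epow_ge0.
- by move=> x _; exact: epow_ge0.
- by apply: filterS fg => x /= h xT; rewrite h.
Qed.

Lemma lux_norm_ge0 f : 0 <= lux_norm f.
Proof.
by apply: le_ereal_inf_tmp => _ [l [l0 _] <-]; rewrite lee_fin ltW.
Qed.

Lemma lux_norm_lt f (l : R) : measurable_fun [set: T] f ->
  lux_norm f < l%:E -> lux_set f l.
Proof.
move=> mf /ereal_inf_lt[_ [k [k0 fk] <-]]; rewrite lte_fin => kl.
have l0 := lt_trans k0 kl.
split => //; apply: le_trans fk; apply: le_modular;
  [exact: measurable_fun_divr|exact: measurable_fun_divr|].
move=> x; rewrite !normrM ler_wpM2l// !normfV.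
by rewrite !gtr0_norm// lef_pV2 ?posrE// ltW.
Qed.

Lemma lux_norm_le f (l : R) : lux_set f l -> lux_norm f <= l%:E.
Proof. by move=> fl; apply: ereal_inf_lbound; exists l. Qed.

Lemma ae_eq_lux_norm f g : measurable_fun [set: T] f ->
  measurable_fun [set: T] g -> f = g %[ae mu] -> lux_norm f = lux_norm g.
Proof.
move=> mf mg fg; congr (ereal_inf (_ @` _)); apply/seteqP.
by split => l [l0 h]; split => //; apply: le_trans h;
  rewrite le_eqVlt; apply/orP; left; apply/eqP/ae_eq_modular;
  try exact: measurable_fun_divr; apply: filterS fg => x /= fgx xT; rewrite fgx.
Qed.

Lemma lux_norm0 : lux_norm (cst 0%R) = 0.
Proof.
apply/eqP; rewrite eq_le lux_norm_ge0 andbT.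
apply/lee_addgt0Pr => e e0; rewrite add0e; apply: lux_norm_le; split => //.
rewrite /modular integral0_eq// => x _.
by rewrite mul0r normr0 epow0//; exact: vexp_ge1.
Qed.

Let ge0_integral_lin (a b : R) (F G : T -> \bar R) : (0 <= a)%R -> (0 <= b)%R ->
  (forall x, 0 <= F x) -> (forall x, 0 <= G x) ->
  measurable_fun [set: T] F -> measurable_fun [set: T] G ->
  \int[mu]_x (a%:E * F x + b%:E * G x) =
  a%:E * \int[mu]_x F x + b%:E * \int[mu]_x G x.
Proof.
move=> a0 b0 F0 G0 mF mG.
rewrite ge0_integralD//; last 4 first.
- by move=> x _; apply: mule_ge0.
- exact: measurable_funeM.
- by move=> x _; apply: mule_ge0.
- exact: measurable_funeM.
by rewrite !ge0_integralZl.
Qed.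

Lemma lux_normD f g : measurable_fun [set: T] f -> measurable_fun [set: T] g ->
  lux_norm (f \+ g)%R <= lux_norm f + lux_norm g.
Proof.
move=> mf mg.
have [->|fy] := eqVneq (lux_norm f) +oo.
  by rewrite addye ?leey// gt_eqF// (lt_le_trans _ (lux_norm_ge0 _)).
have [->|gy] := eqVneq (lux_norm g) +oo.
  by rewrite addey ?leey// gt_eqF// (lt_le_trans _ (lux_norm_ge0 _)).
have ff : lux_norm f \is a fin_num.
  by rewrite ge0_fin_numE ?lux_norm_ge0// ltey.
have gf : lux_norm g \is a fin_num.
  by rewrite ge0_fin_numE ?lux_norm_ge0// ltey.
apply/lee_addgt0Pr => e e0.
have e20 : (0 < e / 2)%R by rewrite divr_gt0.
set k := (fine (lux_norm f) + e / 2)%R; set l := (fine (lux_norm g) + e / 2)%R.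
have [k0 fk] : lux_set f k.
  by apply: lux_norm_lt => //; rewrite EFinD (fineK ff) lteDl ?lte_fin.
have [l0 gl] : lux_set g l.
  by apply: lux_norm_lt => //; rewrite EFinD (fineK gf) lteDl ?lte_fin.
have -> : lux_norm f + lux_norm g + e%:E = (k + l)%:E.
  rewrite -(fineK ff) -(fineK gf) -!EFinD; congr EFin.
  rewrite /k /l; lra.
clearbody k l.
have kl0 : (0 < k + l)%R by rewrite addr_gt0.
apply: lux_norm_le; split => //.
have mfk := measurable_modular (measurable_fun_divr k mf).
have mgl := measurable_modular (measurable_fun_divr l mg).
have klE : (k / (k + l) + l / (k + l) = 1)%R.
  by rewrite -mulrDl divff// gt_eqF.
have a0 : (0 < k / (k + l))%R by rewrite divr_gt0.
have b0 : (0 < l / (k + l))%R by rewrite divr_gt0.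
apply: (@le_trans _ _ (\int[mu]_x ((k / (k + l))%:E * epow `|f x / k|%R (p x) +
    (l / (k + l))%:E * epow `|g x / l|%R (p x)))).
  apply: ge0_le_integral => //.
  - by move=> x _; exact: epow_ge0.
  - by apply/measurable_modular/measurable_fun_divr; exact: measurable_funD.
  - by apply: emeasurable_funD;
      [exact: (measurable_funeM _ mfk)|exact: (measurable_funeM _ mgl)].
  move=> x _; have p1 := vexp_ge1 p x.
  apply: le_trans (epow_convex p1 a0 b0 klE (normr_ge0 _) (normr_ge0 _)).
  apply: le_epow => //.
  rewrite -{1}(gtr0_norm a0) -{1}(gtr0_norm b0) -!normrM.
  apply: le_trans (ler_normD _ _).
  rewrite le_eqVlt; apply/orP; left; apply/eqP; congr (`| _ |)%R.
  by rewrite /=; field; rewrite !gt_eqF.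
rewrite (ge0_integral_lin (ltW a0) (ltW b0) (fun=> epow_ge0 _ _)
  (fun=> epow_ge0 _ _) mfk mgl).
apply: (@le_trans _ _ ((k / (k + l))%:E * 1 + (l / (k + l))%:E * 1)).
  by apply: leeD; rewrite lee_pmul2l ?lte_fin.
by rewrite !mule1 -EFinD klE.
Qed.

Let le_lux_normZ f (a : R) : measurable_fun [set: T] f -> lux_norm f < +oo ->
  lux_norm (a \*: f)%R <= `|a|%:E * lux_norm f.
Proof.
move=> mf fy; have [->|a0] := eqVneq a 0%R.
  rewrite (_ : 0%R \*: f = cst 0%R)%R ?lux_norm0 ?normr0 ?mul0e//.
  by apply/funext => x /=; rewrite scale0r.
have na0 : (0 < `|a|)%R by rewrite normr_gt0.
have ff : lux_norm f \is a fin_num by rewrite ge0_fin_numE ?lux_norm_ge0.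
apply/lee_addgt0Pr => e e0.
set l := (fine (lux_norm f) + e / `|a|)%R.
have [l0 fl] : lux_set f l.
  by apply: lux_norm_lt => //; rewrite EFinD fineK// lteDl// lte_fin divr_gt0.
have -> : `|a|%:E * lux_norm f + e%:E = (`|a| * l)%:E.
  rewrite -(fineK ff) -!EFinM -EFinD; congr EFin; rewrite /l mulrDr.
  by rewrite (mulrCA _ e) divff ?mulr1// gt_eqF.
apply: lux_norm_le; split; first by rewrite mulr_gt0.
apply: le_trans fl; apply: le_modular.
- apply: measurable_fun_divr.
  exact: (@measurable_funM _ _ _ _ (cst a) f).
- exact: measurable_fun_divr.
move=> x /=; rewrite !normrM !normfV normrM normr_id invfM.
by rewrite mulrACA divff ?mul1r// gt_eqF.
Qed.

Lemma lux_normZ f (a : R) : measurable_fun [set: T] f -> lux_norm f < +oo ->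
  lux_norm (a \*: f)%R = `|a|%:E * lux_norm f.
Proof.
move=> mf fy; apply/eqP; rewrite eq_le le_lux_normZ//=.
have [->|a0] := eqVneq a 0%R; first by rewrite normr0 mul0e lux_norm_ge0.
have na0 : (0 < `|a|)%R by rewrite normr_gt0.
have mZ : measurable_fun [set: T] (a \*: f)%R.
  exact: (@measurable_funM _ _ _ _ (cst a) f).
have Zy : lux_norm (a \*: f)%R < +oo.
  by rewrite (le_lt_trans (le_lux_normZ _ _ _))// lte_mul_pinfty// lee_fin ltW.
have := le_lux_normZ a^-1 mZ Zy.
rewrite (_ : a^-1 \*: (a \*: f) = f)%R; last first.
  by apply/funext => x /=; rewrite scalerA mulVf// scale1r.
move=> h; rewrite -[leRHS]mul1e -(@divff _ `|a|%R) ?gt_eqF// EFinM -muleA.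
by rewrite lee_pmul2l// -normfV.
Qed.

Lemma lux_norm_eq0 f : measurable_fun [set: T] f -> lux_norm f = 0 ->
  f = cst 0%R %[ae mu].
Proof.
move=> mf f0.
have mod1 (k : R) : (0 < k)%R -> modular (fun x => f x / k)%R <= 1.
  by move=> k0; have [] : lux_set f k by apply: lux_norm_lt; rewrite ?f0.
have mod0 (k : R) : (0 < k)%R -> modular (fun x => f x / k)%R = 0.
  move=> k0; apply/eqP; rewrite eq_le; apply/andP; split; last first.
    by apply: integral_ge0 => x _; exact: epow_ge0.
  apply/lee_addgt0Pr => e e0; rewrite add0e.
  have [a [a0 a1 ae]] : exists a : R, [/\ 0 < a, a <= 1 & a <= e]%R.
    exists (Num.min e 1%R).
    by rewrite lt_min e0 ltr01 !ge_min !lexx orbT.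
  apply: (@le_trans _ _ a%:E); last by rewrite lee_fin.
  have mfk := measurable_modular (measurable_fun_divr (k * a) mf).
  apply: (@le_trans _ _
      (\int[mu]_x (a%:E * epow `|f x / (k * a)|%R (p x)))).
    apply: ge0_le_integral => //.
    - by move=> x _; exact: epow_ge0.
    - exact/measurable_modular/measurable_fun_divr.
    - exact: measurable_funeM.
    move=> x _; have p1 := vexp_ge1 p x.
    apply: le_trans (epow_scale p1 _ (normr_ge0 _)); last by rewrite a0.
    rewrite le_eqVlt; apply/orP; left; apply/eqP; congr epow.
    have -> : (f x / k = a * (f x / (k * a)))%R by field; rewrite !gt_eqF.
    by rewrite normrM (gtr0_norm a0).
  rewrite ge0_integralZl//; last 2 first.
    by move=> x _; exact: epow_ge0.
    by rewrite lee_fin ltW.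
  by rewrite -[leRHS]mule1 lee_pmul2l// mod1// mulr_gt0.
have ae0 (n : nat) : \forall x \ae mu, epow `|f x / n.+1%:R^-1|%R (p x) = 0.
  have n0 : (0 < n.+1%:R^-1 :> R)%R by rewrite invr_gt0.
  have mn := measurable_modular (measurable_fun_divr n.+1%:R^-1 mf).
  have : \int[mu]_x `|epow `|f x / n.+1%:R^-1|%R (p x)| = 0.
    rewrite -(mod0 _ n0); apply: eq_integral => x _.
    by rewrite gee0_abs// epow_ge0.
  move/(ae_eq_integral_abs mu measurableT mn).
  by apply: filterS => x; exact.
apply: filterS (ae_foralln ae0) => x fx0 _ /=.
apply/eqP; rewrite -normr_eq0 eq_le normr_ge0 andbT.
have := fx0; case: (p x) (vexp_ge1 p x) => [r r1 /(_ 0%N)| _|//].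
  by case => /eqP; rewrite invr1 divr1 powR_eq0 => /andP[/eqP ->].
move=> h; rewrite leNgt; apply/negP => nfx.
have [n nfn] : exists n : nat, (1 < `|f x| * n.+1%:R)%R.
  exists (Num.truncn `|f x|^-1)%R.
  by rewrite mulrC -ltr_pdivrMr// mul1r truncnS_gt.
move: (h n) => /=; rewrite invrK normrM (ger0_norm (ler0n _ _)).
by rewrite leNgt nfn.
Qed.

End luxemburg.

Section vLfun.
Context {d} {T : measurableType d} {R : realType}.
Variables (mu : {measure set T -> \bar R}) (p : vexponent T R).

Lemma vLfunP (f : T -> R) : f \in vLfun mu p <->
  measurable_fun [set: T] f /\ (lux_norm mu p f < +oo)%E.
Proof. by rewrite inE. Qed.

Lemma vLfun_submod_closed : submod_closed (vLfun mu p).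
Proof.
split; first by apply/vLfunP; split; [exact: measurable_cst|rewrite lux_norm0].
move=> a f g /vLfunP[mf fy] /vLfunP[mg gy]; apply/vLfunP.
have maf : measurable_fun [set: T] (a *: f).
  exact: (@measurable_funM _ _ _ _ (cst a) f).
split; first exact: measurable_funD.
rewrite (le_lt_trans (lux_normD _ _ maf mg))// lte_add_pinfty//.
by rewrite lux_normZ// lte_mul_pinfty// lee_fin.
Qed.

HB.instance Definition _ :=
  GRing.isSubmodClosed.Build _ _ (vLfun mu p) vLfun_submod_closed.

Record vLfunType := VLfun {
  vLfun_fun :> T -> R ;
  vLfun_funP : vLfun_fun \in vLfun mu p }.

HB.instance Definition _ := [isSub for vLfun_fun].
HB.instance Definition _ := [Choice of vLfunType by <:].
HB.instance Definition _ := [SubChoice_isSubLmodule of vLfunType by <:].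

Implicit Types f g : vLfunType.

Lemma vLfun_measurable f : measurable_fun [set: T] f.
Proof. by have /vLfunP[] := vLfun_funP f. Qed.

Lemma vLfun_lty f : (lux_norm mu p f < +oo)%E.
Proof. by have /vLfunP[] := vLfun_funP f. Qed.

Definition ae_null : {pred vLfunType} :=
  fun f => `[< (f : T -> R) = cst 0 %[ae mu] >].

Lemma ae_nullP f : f \in ae_null <-> (f : T -> R) = cst 0 %[ae mu].
Proof. by split => [/asboolP|/asboolP]. Qed.

Lemma ae_null_zmod_closed : zmod_closed ae_null.
Proof.
split; first by apply/ae_nullP; apply: aeW.
move=> f g /ae_nullP f0 /ae_nullP g0; apply/ae_nullP.
apply: filterS2 f0 g0 => x /= f0 g0 xT.
by rewrite /GRing.add/= /GRing.opp/= f0// g0// subr0.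
Qed.

HB.instance Definition _ :=
  GRing.isZmodClosed.Build _ ae_null ae_null_zmod_closed.

Definition vLspace : Type := @Quotient.quot vLfunType ae_null.

HB.instance Definition _ := Choice.on vLspace.
HB.instance Definition _ := EqQuotient.on vLspace.
HB.instance Definition _ := GRing.Zmodule.on vLspace.

Local Open Scope quotient_scope.

Lemma vLspace_eqP f g : f = g %[mod vLspace] <-> (f : T -> R) = g %[ae mu].
Proof.
split=> [/eqP|fg].
  rewrite -Quotient.idealrBE => /ae_nullP; apply: filterS => x h xT.
  by apply/eqP; rewrite -subr_eq0; apply/eqP; exact: h.
apply/eqP; rewrite -Quotient.idealrBE; apply/ae_nullP.
by apply: filterS fg => x h xT; apply/eqP; rewrite subr_eq0; apply/eqP/h.
Qed.

Definition vLspace_scale (a : R) (f : vLspace) : vLspace := \pi_vLspace (a *: repr f).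

Lemma vLspace_pi_scale a f :
  vLspace_scale a (\pi_vLspace f) = \pi_vLspace (a *: f).
Proof.
apply/vLspace_eqP.
have /vLspace_eqP : repr (\pi_vLspace f) = f %[mod vLspace] by rewrite reprK.
by apply: filterS => x h xT; congr (a * _); exact: h.
Qed.

Lemma vLspace_piD f g :
  \pi_vLspace f + \pi_vLspace g = \pi_vLspace (f + g).
Proof. by rewrite piE. Qed.

Let scaleA a b (f : vLspace) :
  vLspace_scale a (vLspace_scale b f) = vLspace_scale (a * b) f.
Proof.
rewrite -[f]reprK; move: (repr f) => g.
by rewrite (vLspace_pi_scale b g) !vLspace_pi_scale scalerA.
Qed.

Let scale1 : left_id 1 vLspace_scale.
Proof. by move=> f; rewrite -[f]reprK vLspace_pi_scale scale1r. Qed.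

Let scaleDr : right_distributive vLspace_scale +%R.
Proof.
move=> a f g; rewrite -[f]reprK -[g]reprK vLspace_piD !vLspace_pi_scale.
by rewrite vLspace_piD scalerDr.
Qed.

Let scaleDl (f : vLspace) : {morph vLspace_scale^~ f : a b / a + b}.
Proof.
by move=> a b; rewrite -[f]reprK !vLspace_pi_scale vLspace_piD scalerDl.
Qed.

HB.instance Definition _ :=
  GRing.Zmodule_isLmodule.Build R vLspace scaleA scale1 scaleDr scaleDl.

(* A chosen representative of the class; statements about its values are only
   meaningful up to null sets. *)
Definition vLspace_fun (f : vLspace) : T -> R := repr f.

Definition vLspace_norm (f : vLspace) : R := fine (lux_norm mu p (vLspace_fun f)).

Lemma vLspace_pi_norm f :
  vLspace_norm (\pi_vLspace f) = fine (lux_norm mu p f).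
Proof.
congr fine; apply: ae_eq_lux_norm; try exact: vLfun_measurable.
by apply/vLspace_eqP; rewrite reprK.
Qed.

Let fin_lux f : lux_norm mu p f \is a fin_num.
Proof. by rewrite ge0_fin_numE ?lux_norm_ge0// vLfun_lty. Qed.

Let ler_vLspace_normD (f g : vLspace) :
  vLspace_norm (f + g) <= vLspace_norm f + vLspace_norm g.
Proof.
rewrite -[f]reprK -[g]reprK vLspace_piD !vLspace_pi_norm.
rewrite -fineD; [|exact: fin_lux..].
apply: fine_le; [exact: fin_lux|by rewrite fin_numD !fin_lux|].
by apply: lux_normD; exact: vLfun_measurable.
Qed.

Let vLspace_normZ (a : R) (f : vLspace) :
  vLspace_norm (a *: f) = `|a| * vLspace_norm f.
Proof.
rewrite -[f]reprK [X in vLspace_norm X]vLspace_pi_scale !vLspace_pi_norm.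
rewrite [X in fine X](@lux_normZ _ _ _ mu p (repr f) a).
- by rewrite fineM// fin_lux.
- exact: vLfun_measurable.
- exact: vLfun_lty.
Qed.

Let vLspace_norm0_eq0 (f : vLspace) : vLspace_norm f = 0 -> f = 0.
Proof.
move=> f0; rewrite -[f]reprK.
have -> : 0 = \pi_vLspace 0 by rewrite piE.
apply/vLspace_eqP/(@lux_norm_eq0 _ _ _ _ p); first exact: vLfun_measurable.
by rewrite -(fineK (fin_lux _)); congr EFin.
Qed.

HB.instance Definition _ := Lmodule_isNormed.Build R vLspace
  ler_vLspace_normD vLspace_normZ vLspace_norm0_eq0.

End vLfun.

Coercion vLspace_fun : vLspace >-> Funclass.

Definition bounded_operator (R : realType) (B1 B2 : normedModType R)
    (T : B1 -> B2) : Prop :=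
  linear T /\ exists C : R, forall x, `|T x| <= C * `|x|.

Definition summable_pow (R : realType) (V W : normedModType R) (r : R)
    (u : nat -> V) (v : nat -> W) : Prop :=
  (\sum_(0 <= n <oo) (`|u n| `^ r * `|v n| `^ r)%:E < +oo)%E.

(* [D] plays the role of the dual of [B1], identified through the pairing [pr];
   [nuclear_rep pr r T x' y] says that [T] is the sum of the [x' n (x) y n],
   the series [sum_n pr x (x' n) *: y n] converging in the norm of [B2]. *)
Definition nuclear_rep (R : realType) (B1 D B2 : normedModType R)
    (pr : B1 -> D -> R) (r : R) (T : B1 -> B2)
    (x' : nat -> D) (y : nat -> B2) : Prop :=
  (forall x : B1, series (fun n => pr x (x' n) *: y n) @ \oo --> T x) /\
  summable_pow r x' y.

Definition nuclear (R : realType) (B1 D B2 : normedModType R)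
    (pr : B1 -> D -> R) (r : R) (T : B1 -> B2) : Prop :=
  linear T /\
  exists (x' : nat -> D) (y : nat -> B2), nuclear_rep pr r T x' y.

(* The value [sum_n x'_n(y_n)] for a 1-nuclear representation of [T] picked by
   choice, and 0 if there is none. Independence of the representation (which
   holds when [B] has the approximation property) is not built in. *)
Definition nuclear_trace (R : realType) (B D : normedModType R)
    (pr : B -> D -> R) (T : B -> B) : R :=
  xget 0 [set t : R | exists (x' : nat -> D) (y : nat -> B),
    nuclear_rep pr 1 T x' y /\
    series (fun n => pr (y n) (x' n)) @ \oo --> t].

Definition lp_pairing d (Omega : measurableType d) (R : realType)
    (mu : {measure set Omega -> \bar R}) (p : vexponent Omega R)
    (f : vLspace mu p) (h : vLspace mu (vexp_conj p)) : R :=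
  \int[mu]_x (f x * h x).

Definition kernel_sum (R : realType) (X Y : Type)
    (g : nat -> X -> R) (h : nat -> Y -> R) (x : X) (y : Y) : R :=
  limn (series (fun n => g n x * h n y)).

(* [limn] and the integral being total functions, the first two clauses state
   that the right-hand side of the third one makes sense. *)
Definition kernel_rep d d' (Omega : measurableType d) (Xi : measurableType d')
    (R : realType) (mu : {measure set Omega -> \bar R})
    (nu : {measure set Xi -> \bar R})
    (p : vexponent Omega R) (q : vexponent Xi R)
    (T : vLspace mu p -> vLspace nu q)
    (g : nat -> vLspace nu q) (h : nat -> vLspace mu (vexp_conj p)) : Prop :=
  forall f : vLspace mu p, \forall x \ae nu,
    [/\ \forall y \ae mu, cvgn (series (fun n => g n x * h n y)),
        mu.-integrable [set: Omega] (fun y => (kernel_sum g h x y * f y)%:E) &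
        T f x = \int[mu]_y (kernel_sum g h x y * f y)].

(* Main.v *)
Require Import Defs.
From HB Require Import structures.
From mathcomp Require Import all_boot all_order all_algebra.
From mathcomp Require Import all_classical all_reals all_analysis.
From mathcomp Require Import ess_sup_inf.
From mathcomp Require Import measurable_realfun.
From mathcomp Require Import ring lra.

Import Order.TTheory GRing.Theory Num.Theory.
Import numFieldNormedType.Exports.

Local Open Scope classical_set_scope.
Local Open Scope ring_scope.

(** Everything rests on the duality inequality [int |f h| <= 2 |f| |h|] for
    conjugate exponents ([vL_hoelder]), a consequence of Young's inequality at
    each point.

    Kernels. Since [r <= 1], summability of the [r]-th powers of
    [|g_n| |h_n|] implies summability of the products ([summable_powW]).
    Pairing with indicators of sets of finite measure gives
    [sum_n |g_n(x)| |h_n| < oo] for almost every [x]; for such an [x] the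
    functions [y |-> g_n(x) h_n(y) f(y)] are absolutely summable in [L^1], so
    that sum and integral can be exchanged ([kernel_ae]). The integral formula
    for [T f] therefore says that [T f(x) = sum_n <f, h_n> g_n(x)] for almost
    every [x], and it remains to see that the almost everywhere sum and the
    norm sum of such a series agree. Both follow from Fatou's lemma for the
    Luxemburg norm ([lux_set_fatou], [vL_series_cvg], [vL_series_cvg_ae]).

    Trace. The identity between [sum_n <g_n, h_n>] and the integral of the
    kernel over the diagonal is again an exchange of sum and integral
    ([kernel_diagonal]). The point is that this number depends on [T] only
    ([trace_unique]). For finitely many disjoint cells [E_c] of finite measure,
    averaging over the cells is a finite rank operator, and the trace of [T]
    followed by averaging is
    [sum_c mu(E_c)^-1 int_(E_c) T 1_(E_c)], a function of [T]. It is also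
    [sum_n B(g_n, h_n)], where
    [B(f, h) = sum_c mu(E_c)^-1 (int_(E_c) f) (int_(E_c) h)]
    ([avg_form_trace]). So it is enough to find cells for which [B] is bounded
    by a constant that does not depend on the cells while [B(g_n, h_n)] is close
    to [<g_n, h_n>] for finitely many prescribed [n] ([avg_form_cells]).

    Averages are not uniformly bounded for a variable exponent: on a cell of
    measure [m], passing from the exponent [p(x)] to [p(y)] costs a factor of
    order [m^(-|p(x) - p(y)|)]. This is harmless when [p] oscillates by at most
    [1/k] on the cell and [m >= 2^-k] ([cell_powR_le]). Cut a set of finite
    measure along the values of [p] in steps of [1/k] and along the values of
    the [g_n] in steps that do not depend on [k]. As [p] is bounded there are
    [O(k)] cells, so the cells of measure less than [2^-k] have total measure
    [O(k 2^-k)], and they can be discarded when [k] is large ([good_cells]). *)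

Set Implicit Arguments.
Unset Strict Implicit.
Unset Printing Implicit Defensive.

(** * Young and Hoelder inequalities, and classes of functions *)

Lemma epow_young (R : realType) (a b : R) (s : \bar R) : 0 <= a -> 0 <= b -> (1 <= s)%E ->
  ((a * b)%:E <= epow a s + epow b (hoelder_conjugate s))%E.
Proof.
move=> a0 b0; case: s => [r|_|//] /=.
  rewrite lee_fin le_eqVlt => /predU1P[<-|r1].
    rewrite hoelder_conjugate1 /= powRr1//; case: ifPn => [b1|_].
      by rewrite adde0 lee_fin ler_piMr.
    by rewrite addey ?leey.
  rewrite /hoelder_conjugate/= eqe gt_eqF ?(lt_trans ltr01)//.
  rewrite -EFinB inver subr_eq0 gt_eqF//= lee_fin.
  have r0 : 0 < r by rewrite (lt_trans ltr01).
  have r10 : 0 < r - 1 by rewrite subr_gt0.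
  have q1 : 1 <= r / (r - 1) by rewrite ler_pdivlMr ?mul1r ?lerBlDl ?lerDr.
  have q0 : 0 < r / (r - 1) by rewrite divr_gt0.
  apply: (le_trans (@conjugate_powR R a b r (r / (r - 1)) a0 b0 r0 q0 _)).
    by field; rewrite !gt_eqF.
  by apply: lerD; rewrite ler_piMr ?powR_ge0// invf_le1// ltW.
rewrite powRr1//; case: ifPn => [a1|_].
  by rewrite add0e lee_fin ler_piMl.
by rewrite addye ?leey.
Qed.

(** A Luxemburg norm is an infimum that need not be attained, so estimates are
    first proved for numbers strictly above the norms. *)
Lemma le_bilinear_limit (R : realType) (X C A B : R) : 0 <= C -> 0 <= A -> 0 <= B ->
  (forall a b, A < a -> B < b -> X <= C * (a * b)) -> X <= C * (A * B).
Proof.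
move=> C0 A0 B0 h; apply/ler_addgt0Pr => e e0.
(* [C (A + t) (B + t) - C A B = C t (A + B + t)], with [t <= 1] *)
pose t := Num.min 1 (e / (C * (A + B + 1) + 1)).
have D0 : 0 < C * (A + B + 1) + 1 by rewrite ltr_wpDl// mulr_ge0// !addr_ge0.
have t0 : 0 < t by rewrite lt_min ltr01/= divr_gt0.
have t1 : t <= 1 by rewrite ge_min lexx.
have te : t * (C * (A + B + 1) + 1) <= e by rewrite -ler_pdivlMr// ge_min lexx orbT.
apply: (le_trans (h (A + t) (B + t) _ _)); rewrite ?ltrDl//.
have : 0 <= C * t by rewrite mulr_ge0// ltW.
nra.
Qed.

Section lp.
Context {d} {T : measurableType d} {R : realType}.
Variables (mu : {measure set T -> \bar R}).

(** Young's inequality for [f / a] and [h / b], whose modulars are at most 1;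
    the two modulars add up to the constant 2. *)
Lemma hoelder_lux_set (p : vexponent T R) (f h : T -> R) a b :
  measurable_fun setT f -> measurable_fun setT h ->
  lux_set mu p f a -> lux_set mu (vexp_conj p) h b ->
  (\int[mu]_x `|(f x * h x)%:E| <= (2 * (a * b))%:E)%E.
Proof.
move=> mf mh [a0 fa] [b0 hb].
have mfa := measurable_modular p (measurable_fun_divr a mf).
have mhb := measurable_modular (vexp_conj p) (measurable_fun_divr b mh).
apply: (@le_trans _ _ (\int[mu]_x ((a * b)%:E *
    (epow `|f x / a|%R (p x) + epow `|h x / b|%R (vexp_conj p x))))%E).
  apply: ge0_le_integral => //.
  - by do 2 apply: measurableT_comp => //; exact: measurable_funM.
  - apply: measurable_funeM; exact: emeasurable_funD.
  move=> x _.
  have -> : (`|(f x * h x)%:E| = (a * b)%:E * (`|f x / a| * `|h x / b|)%:E)%E.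
    rewrite abse_EFin -EFinM; congr EFin.
    rewrite !normrM !normfV (gtr0_norm a0) (gtr0_norm b0).
    by field; rewrite !gt_eqF.
  rewrite lee_pmul2l ?lte_fin ?mulr_gt0//.
  exact: (epow_young _ _ (vexp_ge1 p x)).
rewrite ge0_integralZl//; last 3 first.
- exact: emeasurable_funD.
- by move=> x _; rewrite adde_ge0 ?epow_ge0.
- by rewrite lee_fin ltW// mulr_gt0.
rewrite ge0_integralD//; [|by move=> x _; exact: epow_ge0..].
apply: (@le_trans _ _ ((a * b)%:E * (1 + 1))%E).
  by rewrite lee_pmul2l ?lte_fin ?mulr_gt0// leeD.
by rewrite -EFinD -EFinM lee_fin mulrC.
Qed.

Section space.
Variable p : vexponent T R.
Implicit Types f g : vLspace mu p.

Lemma vL_measurable f : measurable_fun setT f.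
Proof. exact: vLfun_measurable. Qed.

Lemma vL_norm_fin f : (lux_norm mu p f = `|f|%:E)%E.
Proof.
by rewrite -[RHS]/(fine (lux_norm mu p f))%:E fineK// ge0_fin_numE
  ?lux_norm_ge0// vLfun_lty.
Qed.

Lemma vL_lux_set f l : `|f| < l -> lux_set mu p f l.
Proof.
by move=> fl; apply: lux_norm_lt; [exact: vL_measurable|rewrite vL_norm_fin lte_fin].
Qed.

Lemma vL_add_ae f g : ((f + g : vLspace mu p) : T -> R) = (fun x => f x + g x) %[ae mu].
Proof.
suff /vLspace_eqP : (repr (f + g : vLspace mu p) = repr f + repr g %[mod (vLspace mu p)])%qT by [].
by rewrite -vLspace_piD !reprK.
Qed.

Lemma vL_scale_ae a f : ((a *: f : vLspace mu p) : T -> R) = (fun x => a * f x) %[ae mu].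
Proof.
suff /vLspace_eqP : (repr (a *: f : vLspace mu p) = a *: repr f %[mod (vLspace mu p)])%qT by [].
by rewrite -vLspace_pi_scale !reprK.
Qed.

Lemma vL_zero_ae : ((0 : vLspace mu p) : T -> R) = cst 0 %[ae mu].
Proof.
suff /vLspace_eqP : (repr (0 : vLspace mu p) = 0 %[mod (vLspace mu p)])%qT by [].
by rewrite reprK piE.
Qed.

Lemma vL_sum_ae (a : nat -> R) (g : nat -> vLspace mu p) n :
  ((series (fun i => a i *: g i) n : vLspace mu p) : T -> R) =
  (fun x => series (fun i => a i * g i x) n) %[ae mu].
Proof.
elim: n => [|n IH].
  rewrite /series/= big_geq//.
  by apply: filterS vL_zero_ae => x h /h ->; rewrite big_geq.
rewrite seriesSr.
have := vL_add_ae (series (fun i => a i *: g i) n) (a n *: g n).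
apply: filterS3 IH (vL_scale_ae (a n) (g n)) => x h1 h2 h3 xT.
by rewrite h3// h1// h2// [RHS]seriesSr.
Qed.

(** As every exponent is at least 1, [l^-1 1_D] has modular at most
    [mu(D) / l] when [1 <= l], whatever the exponent. *)
Lemma vL_indic_ex (D : set T) : measurable D -> (mu D < +oo)%E ->
  exists e : vLspace mu p, (e : T -> R) = \1_D %[ae mu].
Proof.
move=> mD Dy.
have mI : measurable_fun setT (\1_D : T -> R) by exact: measurable_indic.
have fD : mu D \is a fin_num by rewrite ge0_fin_numE.
suff eP : (\1_D : T -> R) \in vLfun mu p.
  exists (\pi_(vLspace mu p) (VLfun eP))%qT.
  suff /vLspace_eqP : (repr (\pi_(vLspace mu p) (VLfun eP)) = VLfun eP %[mod (vLspace mu p)])%qT by [].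
  by rewrite reprK.
apply/vLfunP; split => //.
set l := Num.max 1 (fine (mu D)).
have l1 : 1 <= l by rewrite le_max lexx.
have l0 : 0 < l by rewrite (lt_le_trans ltr01).
have Dl : (mu D <= l%:E)%E by rewrite -(fineK fD) lee_fin le_max lexx orbT.
apply: (@le_lt_trans _ _ l%:E); last exact: ltry.
apply: lux_norm_le; split => //.
apply: (@le_trans _ _ (\int[mu]_x (l^-1%:E * (\1_D x)%:E))%E).
  apply: ge0_le_integral => //.
  - by move=> x _; exact: epow_ge0.
  - by apply: measurable_modular; exact: measurable_fun_divr.
  - by apply: measurable_funeM; exact/measurable_EFinP.
  move=> x _; have p1 := vexp_ge1 p x.
  rewrite [in (\1_D x / l)%R]mulrC normrM (@gtr0_norm _ l^-1) ?invr_gt0//.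
  apply: (le_trans (epow_scale p1 _ (normr_ge0 _))).
    by rewrite invr_gt0 l0 invf_le1.
  rewrite lee_pmul2l ?lte_fin ?invr_gt0// indicE.
  case: (x \in D) => /=; last by rewrite normr0 epow0.
  by rewrite normr1; case: (p x) p1 => [r| |]//= _; rewrite ?powR1 ?lexx.
rewrite ge0_integralZl//; last 2 first.
- exact/measurable_EFinP.
- by rewrite lee_fin invr_ge0 ltW.
rewrite integral_indic// setIT -(fineK fD) -EFinM lee_fin mulrC ler_pdivrMr// mul1r.
by rewrite -lee_fin fineK.
Qed.

End space.
End lp.

(** * Absolutely summable series and termwise integration *)

Section series_facts.
Context {R : realType}.
Implicit Types a u : nat -> R.

Lemma nneseries_lty_cvg a : (forall n, 0 <= a n) ->
  (\sum_(0 <= n <oo) (a n)%:E < +oo)%E -> cvgn (series a).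
Proof.
move=> a0 ay; apply: nondecreasing_is_cvgn; first exact: nondecreasing_series.
have a0' : forall n, (0 <= n)%N -> true -> (0 <= (a n)%:E)%E by move=> n _ _; rewrite lee_fin.
exists (fine (\sum_(0 <= n <oo) (a n)%:E)%E) => _ [n _ <-].
rewrite -lee_fin fineK ?ge0_fin_numE ?nneseries_ge0//.
by rewrite /series/= -sumEFin; exact: nneseries_lim_ge.
Qed.

Lemma cvg_nneseries_lty a : (forall n, 0 <= a n) ->
  cvgn (series a) -> (\sum_(0 <= n <oo) (a n)%:E < +oo)%E.
Proof.
move=> a0 ca; apply: (@le_lt_trans _ _ (limn (series a))%:E); last exact: ltry.
apply: lime_le; first by apply: is_cvg_nneseries => n _ _; rewrite lee_fin.
apply: nearW => n; rewrite sumEFin lee_fin.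
apply: (@nondecreasing_cvgn_le _ (series a)) => //; exact: nondecreasing_series.
Qed.

Lemma abs_summable_cvg u :
  (\sum_(0 <= n <oo) `|(u n)%:E| < +oo)%E -> cvgn (series u).
Proof. by move=> uy; apply: normed_cvg; exact: (@nneseries_lty_cvg (fun n => `|u n|)). Qed.

Lemma series_tail_small a e : cvgn (series a) -> 0 < e ->
  exists N, forall n, (N <= n)%N -> \sum_(N <= i < n) a i <= e.
Proof.
move=> /cvg_ex[l al] e0.
have e20 : 0 < e / 2 by rewrite divr_gt0.
have /cvgrPdist_le/(_ _ e20)[N _ hN] := al.
exists N => n Nn; rewrite -sub_series_geq//.
have h1 := hN N (leqnn N); have h2 := hN n Nn.
move: h1 h2 => /= /ler_normlP[h1 h2] /ler_normlP[h3 h4].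
by lra.
Qed.

End series_facts.

Section termwise.
Context {d} {T : measurableType d} {R : realType}.
Variables (mu : {measure set T -> \bar R}).

Lemma ae_eq_Rintegral (f g : T -> R) : measurable_fun setT f -> measurable_fun setT g ->
  f = g %[ae mu] -> \int[mu]_x f x = \int[mu]_x g x.
Proof.
move=> mf mg fg; congr fine; apply: ae_eq_integral => //; try exact/measurable_EFinP.
by apply: filterS fg => x h xT; rewrite h.
Qed.

Lemma ae_summable (F : nat -> T -> R) : (forall n, measurable_fun setT (F n)) ->
  (\sum_(0 <= n <oo) \int[mu]_x `|(F n x)%:E| < +oo)%E ->
  \forall x \ae mu, (\sum_(0 <= n <oo) `|(F n x)%:E| < +oo)%E.
Proof.
move=> mF; rewrite -integral_nneseries//; last first.
  by move=> n; apply: measurableT_comp => //; exact/measurable_EFinP.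
set S := fun x => _ => Sy.
have S0 x : (0 <= S x)%E by apply: nneseries_ge0.
have iS : mu.-integrable setT S.
  apply/integrableP; split; last by under eq_integral do rewrite gee0_abs//.
  apply: ge0_emeasurable_sum => // n x; apply: measurableT_comp => //.
  exact/measurable_EFinP.
apply: filterS (integrable_ae measurableT iS) => x /(_ I).
by rewrite ge0_fin_numE.
Qed.

(** Dominated convergence with dominating function [sum_n |F_n|]. The function
    [S] is prescribed almost everywhere only; it is measurable because [mu] is
    complete. *)
Lemma cvg_series_integral (mu_complete : measure_is_complete mu)
    (F : nat -> T -> R) (S : T -> R) :
  (forall n, measurable_fun setT (F n)) ->
  (\sum_(0 <= n <oo) \int[mu]_x `|(F n x)%:E| < +oo)%E ->
  (\forall x \ae mu, series (F ^~ x) @ \oo --> S x) ->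
  mu.-integrable setT (EFin \o S) /\
  series (fun n => \int[mu]_x F n x) @ \oo --> \int[mu]_x S x.
Proof.
move=> mF Fy FS.
have mF' n : measurable_fun setT (fun x => `|(F n x)%:E|%E).
  by apply: measurableT_comp => //; exact/measurable_EFinP.
have mSn n : measurable_fun setT (fun x => (series (F ^~ x) n)%:E).
  apply/measurable_EFinP; rewrite /series/=.
  exact: measurable_sum.
pose G x := (\sum_(0 <= n <oo) `|(F n x)%:E|)%E.
have G0 x : (0 <= G x)%E by exact: nneseries_ge0.
have iG : mu.-integrable setT G.
  apply/integrableP; split; first by apply: ge0_emeasurable_sum.
  under eq_integral do rewrite gee0_abs//.
  by rewrite /G integral_nneseries.
have FS' : \forall x \ae mu, setT x -> (fun n => (series (F ^~ x) n)%:E) @ \oo --> (S x)%:E.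
  by apply: filterS FS => x h _; apply: cvg_EFin => //; exact: nearW.
have mS : measurable_fun setT (EFin \o S).
  apply: (ae_measurable_fun mu_complete) (measurable_fun_limn_esup mSn).
  apply: filterS FS' => x h xT /=.
  by have [_ ->] := cvg_limn_einf_sup (h xT).
have FG : \forall x \ae mu, forall n, setT x -> (`|(series (F ^~ x) n)%:E| <= G x)%E.
  apply: aeW => x n _; apply: (@le_trans _ _ (\sum_(0 <= k < n) `|(F k x)%:E|)%E).
    by rewrite sumEFin lee_fin /series/= ler_norm_sum.
  exact: nneseries_lim_ge.
have [iS _ cS] := dominated_convergence measurableT mSn mS FS' iG FG.
split => //.
have iF n : mu.-integrable setT (EFin \o F n).
  apply/integrableP; split; first exact/measurable_EFinP.
  apply: le_lt_trans Fy.
  apply: le_trans (nneseries_lim_ge n.+1 _); last by move=> *; exact: integral_ge0.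
  by rewrite big_nat_recr//= leeDr// sume_ge0// => *; exact: integral_ge0.
have -> : series (fun n => \int[mu]_x F n x) =
    (fun n => fine (\int[mu]_x (series (F ^~ x) n)%:E)%E).
  apply/funext => n; rewrite /series/=.
  elim: n => [|n IH].
    rewrite big_geq//; under eq_integral do rewrite big_geq//.
    by rewrite integral0.
  rewrite big_nat_recr//= IH -[LHS]/(\int[mu]_x _ + _)%R -RintegralD//.
    by congr fine; apply: eq_integral => x _; rewrite big_nat_recr.
  have := @integrable_sum _ _ _ mu setT measurableT _ (index_iota 0 n) xpredT
    (fun k x => (F k x)%:E) (fun k _ => iF k).
  by apply: eq_integrable => // x _; rewrite /= sumEFin.
apply: fine_cvg; rewrite fineK//.
exact: integrable_fin_num.
Qed.

End termwise.

(** * The pairing of conjugate spaces *)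

Section pairing.
Context {d} {T : measurableType d} {R : realType}.
Variables (mu : {measure set T -> \bar R}) (p : vexponent T R).
Implicit Types (f g : vLspace mu p) (h : vLspace mu (vexp_conj p)).

Lemma vL_hoelder f h :
  (\int[mu]_x `|(f x * h x)%:E| <= (2 * (`|f| * `|h|))%:E)%E.
Proof.
have I0 : (0 <= \int[mu]_x `|(f x * h x)%:E|)%E by exact: integral_ge0.
have bnd a b : `|f| < a -> `|h| < b ->
    (\int[mu]_x `|(f x * h x)%:E| <= (2 * (a * b))%:E)%E.
  by move=> fa hb; apply: hoelder_lux_set; [exact: vL_measurable..|exact: vL_lux_set|exact: vL_lux_set].
have If : (\int[mu]_x `|(f x * h x)%:E|)%E \is a fin_num.
  rewrite ge0_fin_numE//; apply: le_lt_trans (ltry _).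
  by apply: (bnd (`|f| + 1) (`|h| + 1)); rewrite ltrDl.
rewrite -(fineK If) lee_fin; apply: le_bilinear_limit => // a b fa hb.
by rewrite -lee_fin fineK// bnd.
Qed.

Lemma vL_mul_measurable f h : measurable_fun setT (fun x => f x * h x).
Proof. by apply: measurable_funM; exact: vL_measurable. Qed.

Lemma vL_mul_integrable f h : mu.-integrable setT (fun x => (f x * h x)%:E).
Proof.
apply/integrableP; split; first exact/measurable_EFinP/vL_mul_measurable.
exact: le_lt_trans (vL_hoelder f h) (ltry _).
Qed.

Lemma lp_pairing_le f h : `|lp_pairing f h| <= 2 * (`|f| * `|h|).
Proof.
rewrite -lee_fin EFin_normr_Rintegral//; last exact: vL_mul_integrable.
apply: le_trans (vL_hoelder f h); apply: le_abse_integral => //.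
exact/measurable_EFinP/vL_mul_measurable.
Qed.

Lemma lp_pairingDl f g h : lp_pairing (f + g) h = lp_pairing f h + lp_pairing g h.
Proof.
rewrite /lp_pairing -RintegralD//; [|exact: vL_mul_integrable..].
apply: ae_eq_Rintegral; first exact: vL_mul_measurable.
  by apply: measurable_funD; exact: vL_mul_measurable.
by apply: filterS (vL_add_ae f g) => x e xT; rewrite e// mulrDl.
Qed.

Lemma lp_pairingZl a f h : lp_pairing (a *: f) h = a * lp_pairing f h.
Proof.
rewrite /lp_pairing -RintegralZl//; last exact: vL_mul_integrable.
apply: ae_eq_Rintegral; first exact: vL_mul_measurable.
  by apply: (@measurable_funM _ _ _ _ (cst a)) => //; exact: vL_mul_measurable.
by apply: filterS (vL_scale_ae a f) => x e xT; rewrite e// mulrA.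
Qed.

Lemma lp_pairing_series (a : nat -> R) (g : nat -> vLspace mu p) h n :
  lp_pairing (series (fun i => a i *: g i) n) h =
  series (fun i => a i * lp_pairing (g i) h) n.
Proof.
elim: n => [|n IH].
  have := lp_pairingZl 0 0 h; rewrite scale0r mul0r.
  by rewrite /series/= !big_geq.
by rewrite !seriesSr lp_pairingDl lp_pairingZl IH.
Qed.

Lemma cvg_lp_pairing (u : nat -> vLspace mu p) f h :
  u @ \oo --> f -> (fun n => lp_pairing (u n) h) @ \oo --> lp_pairing f h.
Proof.
move=> uf; apply/cvgrPdist_le => e e0.
have d0 : 0 < e / (2 * `|h| + 1) by rewrite divr_gt0// ltr_wpDl// mulr_ge0.
move/cvgrPdist_le : uf => /(_ _ d0); apply: filterS => n un.
have -> : lp_pairing f h - lp_pairing (u n) h = lp_pairing (f - u n) h.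
  by rewrite lp_pairingDl -[in RHS]scaleN1r lp_pairingZl mulN1r.
apply: le_trans (lp_pairing_le _ _) _.
apply: (@le_trans _ _ (2 * (e / (2 * `|h| + 1) * `|h|))).
  by rewrite ler_pM2l// ler_wpM2r.
rewrite [leRHS](_ : e = e / (2 * `|h| + 1) * (2 * `|h| + 1)).
  by have := ltW d0; lra.
by rewrite divfK// gt_eqF// ltr_wpDl// mulr_ge0.
Qed.

End pairing.

(** * Fatou's lemma for the Luxemburg norm, and series in norm and pointwise *)

Lemma le_limn_einf (R : realType) (u : (\bar R)^nat) (c : \bar R) :
  (\forall n \near \oo, (c <= u n)%E) -> (c <= limn_einf u)%E.
Proof.
move=> [N _ cu]; rewrite limn_einf_lim; apply: lime_ge; first exact: is_cvg_einfs.
near=> n; apply: le_ereal_inf_tmp => _ [m /= nm <-]; apply: cu => /=.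
by apply: leq_trans nm; near: n; exists N.
Unshelve. all: by end_near. Qed.

Section fatou_norm.
Context {d} {T : measurableType d} {R : realType}.
Variables (mu : {measure set T -> \bar R}) (p : vexponent T R).

(** The strict inequality [l < k] replaces the continuity of [epow]: where
    [f x <> 0], eventually [|f x| / k <= |u_n x| / l], which also covers the
    points where the exponent is infinite. *)
Lemma lux_set_fatou (u : nat -> T -> R) (f : T -> R) (l k : R) :
  (forall n, measurable_fun setT (u n)) -> measurable_fun setT f ->
  (\forall n \near \oo, lux_set mu p (u n) l) ->
  (\forall x \ae mu, u ^~ x @ \oo --> f x) -> l < k -> lux_set mu p f k.
Proof.
move=> mun mf [N _ ul] uf lk.
have l0 : 0 < l by have [] := ul N (leqnn N).
have k0 := lt_trans l0 lk.
split => //.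
pose F n x := epow `|u n x / l| (p x).
have mF n : measurable_fun setT (F n).
  by apply: measurable_modular; exact: measurable_fun_divr.
have F0 n x : setT x -> (0 <= F n x)%E by move=> _; exact: epow_ge0.
have := fatou mu measurableT mF F0.
move=> fat; apply: le_trans (le_trans fat _); last first.
  rewrite limn_einf_lim; apply: lime_le; first exact: is_cvg_einfs.
  near=> n; apply: (@le_trans _ _ (\int[mu]_x F n x)%E).
    by apply: ereal_inf_lbound; exists n => /=.
  by have [] := ul n; [near: n; exists N|].
apply: ae_ge0_le_integral => //.
- by move=> x _; exact: epow_ge0.
- by apply: measurable_modular; exact: measurable_fun_divr.
- by move=> x _; apply: le_limn_einf; apply: nearW => n; exact: epow_ge0.
- under eq_fun do rewrite -[limn_einf _]oppeK.
  apply: measurableT_comp => //=.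
  under eq_fun do rewrite /limn_einf oppeK.
  by apply: measurable_fun_limn_esup => n; apply: measurableT_comp.
apply: filterS uf => x ufx _; apply: le_limn_einf.
have [->|fx0] := eqVneq (f x) 0.
  by apply: nearW => n; rewrite mul0r normr0 epow0 ?epow_ge0// vexp_ge1.
have nfx : 0 < `|f x| by rewrite normr_gt0.
have ufn : (fun n => `|u n x|) @ \oo --> `|f x| by apply: cvg_norm.
have : `|f x| * (l / k) < `|f x| by rewrite gtr_pMr// ltr_pdivrMr// mul1r.
move=> /(cvgr_gt _ ufn); apply: filterS => n un.
apply: le_epow => //; first exact: vexp_ge1.
rewrite !normrM !normfV (gtr0_norm l0) (gtr0_norm k0).
rewrite ler_pdivlMr// -mulrA (mulrC k^-1) ltW//.
Unshelve. all: by end_near. Qed.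

End fatou_norm.

Section function_series.
Context {d} {T : measurableType d} {R : realType}.
Variables (mu : {measure set T -> \bar R}) (p : vexponent T R).
Variables (a : nat -> R) (g : nat -> vLspace mu p).

(** Fatou's lemma, applied to the differences of partial sums from rank [n] on,
    bounds [s - S_n] by the tail of the series of norms. *)
Lemma vL_series_cvg (s : vLspace mu p) :
  cvgn (series (fun n => `|a n| * `|g n|)) ->
  (\forall x \ae mu, series (fun n => a n * g n x) @ \oo --> s x) ->
  series (fun n => a n *: g n) @ \oo --> s.
Proof.
move=> cag gs; apply/cvgrPdist_le => e e0.
have e20 : 0 < e / 2 by rewrite divr_gt0.
have e40 : 0 < e / 2 / 2 by rewrite divr_gt0.
have [N hN] := series_tail_small cag e40.
pose S := series (fun n => a n *: g n).
exists N => // n /= Nn.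
suff : lux_set mu p (s - S n : vLspace mu p) e.
  by move/lux_norm_le; rewrite vL_norm_fin lee_fin.
apply: (@lux_set_fatou _ _ _ mu p
    (fun m => (S (n + m)%N - S n : vLspace mu p) : T -> R) _ (e / 2)).
- by move=> m; exact: vL_measurable.
- exact: vL_measurable.
- apply: nearW => m; apply: vL_lux_set; apply: (@le_lt_trans _ _ (e / 2 / 2)).
    rewrite /S sub_series_geq ?leq_addr//.
    apply: (le_trans (ler_norm_sum _ _ _)).
    apply: le_trans (hN (n + m)%N _); last by rewrite (leq_trans Nn)// leq_addr.
    rewrite [leRHS](@big_cat_nat _ _ _ n)//= ?leq_addr//.
    apply: ler_wpDl; first by apply: sumr_ge0 => i _; rewrite mulr_ge0.
    by apply: ler_sum => i _; rewrite normrZ.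
  by rewrite ltr_pdivrMr// mulr2n mulrDr mulr1 ltrDl.
- have hB (f1 f2 : vLspace mu p) : \forall x \ae mu, (f1 - f2 : vLspace mu p) x = f1 x - f2 x.
    rewrite -scaleN1r.
    apply: filterS2 (vL_add_ae f1 (-1 *: f2)) (vL_scale_ae (-1) f2) => x h1 h2.
    by rewrite h1// h2// mulN1r.
  have h1 : \forall x \ae mu, forall m, (S (n + m)%N - S n : vLspace mu p) x =
     series (fun i => a i * g i x) (n + m)%N - series (fun i => a i * g i x) n.
    apply: ae_foralln => m.
    apply: filterS3 (hB (S (n + m)%N) (S n)) (vL_sum_ae a g (n + m)%N) (vL_sum_ae a g n).
    by move=> x -> -> // ->.
  have h2 : \forall x \ae mu,
      (s - S n : vLspace mu p) x = s x - series (fun i => a i * g i x) n.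
    by apply: filterS2 (hB s (S n)) (vL_sum_ae a g n) => x -> ->.
  apply: filterS3 h1 gs h2.
  move=> x {}h1 {}h2 ->; rewrite (_ : (fun m => _) = (fun m => series (fun i => a i * g i x) (n + m)%N
       - series (fun i => a i * g i x) n)); last by apply/funext => m; exact: h1.
  apply: cvgB; last exact: cvg_cst.
  have : (fun m => series (fun i => a i * g i x) (m + n)%N) @ \oo --> s x.
    by move: h2; rewrite -(cvg_shiftn n).
  by apply: cvg_trans; apply: near_eq_cvg; apply: nearW => m; rewrite addnC.
by rewrite ltr_pdivrMr// mulr2n mulrDr mulr1 ltrDl.
Qed.

(** Let [S] be the pointwise sum. Fatou's lemma, applied to [s - S_n] from an
    arbitrary rank on, shows that [s - S] has norm 0. *)
Lemma vL_series_cvg_ae (s : vLspace mu p) :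
  series (fun n => a n *: g n) @ \oo --> s ->
  (\forall x \ae mu, cvgn (series (fun n => a n * g n x))) ->
  \forall x \ae mu, series (fun n => a n * g n x) @ \oo --> s x.
Proof.
move=> gs cag.
pose u n (x : T) := series (fun n => a n * g n x) n.
have mu_ n : measurable_fun setT (u n).
  apply: measurable_sum => i; apply: (@measurable_funM _ _ _ _ (cst _)) => //.
  exact: vL_measurable.
(* a version of the pointwise sum that is measurable everywhere *)
pose S x := fine (limn_esup (fun n => (u n x)%:E)).
have mS : measurable_fun setT S.
  apply: measurableT_comp => //; apply: measurable_fun_limn_esup => n.
  exact/measurable_EFinP.
have uS : \forall x \ae mu, u ^~ x @ \oo --> S x.
  apply: filterS cag => x /cvg_ex[l ul]; rewrite /S.
  suff -> : limn_esup (fun n => (u n x)%:E) = l%:E by [].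
  by apply: (cvg_limn_einf_sup _).2; apply: cvg_EFin => //; exact: nearW.
suff sS : (fun x => s x - S x) = cst 0 %[ae mu].
  apply: filterS2 uS sS => x h1 /(_ I)/eqP; rewrite subr_eq0 => /eqP ->.
  exact: h1.
have ms : measurable_fun setT (fun x => s x - S x).
  by apply: measurable_funB => //; exact: vL_measurable.
apply: (@lux_norm_eq0 _ _ _ _ p) => //.
apply/eqP; rewrite eq_le lux_norm_ge0 andbT; apply/lee_addgt0Pr => e e0; rewrite add0e.
have e20 : 0 < e / 2 by rewrite divr_gt0.
apply: lux_norm_le.
apply: (@lux_set_fatou _ _ _ mu p
   (fun m => (s - series (fun n => a n *: g n) m : vLspace mu p) : T -> R) _ (e / 2)).
- by move=> m; exact: vL_measurable.
- exact: ms.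
- move/cvgrPdist_lt : gs => /(_ _ e20); apply: filterS => m sm.
  exact: vL_lux_set.
- have h1 : \forall x \ae mu, forall m,
      (s - series (fun n => a n *: g n) m : vLspace mu p) x = s x - u m x.
    apply: ae_foralln => m; rewrite -scaleN1r.
    apply: filterS3 (vL_add_ae s (-1 *: series (fun n => a n *: g n) m))
      (vL_scale_ae (-1) (series (fun n => a n *: g n) m)) (vL_sum_ae a g m).
    by move=> x h1 h2 h3; rewrite h1// h2// h3// mulN1r.
  apply: filterS2 h1 uS => x h1 h2.
  rewrite (_ : (fun m => _) = (fun m => s x - u m x)); last by apply/funext => m; exact: h1.
  by apply: cvgB; [exact: cvg_cst|exact: h2].
by rewrite ltr_pdivrMr// mulr2n mulrDr mulr1 ltrDl.
Qed.

End function_series.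

(** * Local integrability *)

Section local_bounds.
Context {d} {T : measurableType d} {R : realType}.

Lemma ae_sigma_finite (mu : {sigma_finite_measure set T -> \bar R}) (P : T -> Prop) :
  (forall D, measurable D -> (mu D < +oo)%E -> \forall x \ae mu, D x -> P x) ->
  \forall x \ae mu, P x.
Proof.
move=> h; have [F FT Ffin] := sigma_finiteT mu.
have hn : forall n, \forall x \ae mu, F n x -> P x.
  by move=> n; have [mF Fy] := Ffin n; exact: h.
apply: filterS (ae_foralln hn) => x hx.
have : [set: T] x by []. by rewrite FT => -[n _ /hx].
Qed.

(** Duality with the indicator of [D]. *)
Lemma vL_local_bound (mu : {measure set T -> \bar R}) (p : vexponent T R) (D : set T) :
  measurable D -> (mu D < +oo)%E ->
  exists2 K, 0 <= K & forall g : vLspace mu p,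
    (\int[mu]_x `|(g x * \1_D x)%:E| <= (K * `|g|)%:E)%E.
Proof.
move=> mD Dy; have [e eD] := vL_indic_ex (vexp_conj p) mD Dy.
exists (2 * `|e|) => [|g]; first by rewrite mulr_ge0.
apply: le_trans (_ : _ <= \int[mu]_x `|(g x * e x)%:E|)%E _.
  rewrite le_eqVlt; apply/orP; left; apply/eqP; apply: ge0_ae_eq_integral => //.
  - apply: measurableT_comp => //; apply/measurable_EFinP.
    by apply: measurable_funM; [exact: vL_measurable|exact: measurable_indic].
  - apply: measurableT_comp => //; apply/measurable_EFinP; exact: vL_mul_measurable.
  - by apply: filterS eD => x h xT; rewrite h.
by apply: le_trans (vL_hoelder g e) _; rewrite lee_fin -mulrA (mulrC `|e|).
Qed.

(** On a set of finite measure the series of integrals converges, by the local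
    bound; such sets cover the space. *)
Lemma vL_abs_summable_ae (mu : {sigma_finite_measure set T -> \bar R})
    (p : vexponent T R) (c : nat -> R) (g : nat -> vLspace mu p) :
  (\sum_(0 <= n <oo) (`|c n| * `|g n|)%:E < +oo)%E ->
  \forall x \ae mu, (\sum_(0 <= n <oo) `|(c n * g n x)%:E| < +oo)%E.
Proof.
move=> cg; apply: ae_sigma_finite => D mD Dy.
have [K K0 gK] := vL_local_bound p mD Dy.
have mF n : measurable_fun setT (fun x => c n * (g n x * \1_D x)).
  apply: (@measurable_funM _ _ _ _ (cst _)) => //.
  by apply: measurable_funM; [exact: vL_measurable|exact: measurable_indic].
have /(ae_summable mF) : (\sum_(0 <= n <oo)
    \int[mu]_x `|(c n * (g n x * \1_D x))%:E| < +oo)%E.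
  apply: (@le_lt_trans _ _ (\sum_(0 <= n <oo) K%:E * (`|c n| * `|g n|)%:E)%E).
    apply: lee_nneseries => [n _ _|n _]; first exact: integral_ge0.
    under eq_integral do rewrite EFinM abseM.
    rewrite ge0_integralZl//; last first.
      apply: measurableT_comp => //; apply/measurable_EFinP.
      by apply: measurable_funM; [exact: vL_measurable|exact: measurable_indic].
    rewrite -EFinM mulrCA EFinM.
    by apply: lee_pmul => //; exact: integral_ge0.
  rewrite nneseriesZl; last by move=> *; rewrite lee_fin mulr_ge0.
  by apply: lte_mul_pinfty.
apply: filterS => x; under eq_eseriesr do rewrite indicE.
move=> h Dx; move: h; rewrite mem_set//=.
by under eq_eseriesr do rewrite mulr1.
Qed.

End local_bounds.

(** * Summability of powers *)

(** The terms [t_n] have bounded powers [t_n^r], hence a bound [B], and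
    [t_n = t_n^r t_n^(1-r) <= B^(1-r) t_n^r]. *)
Lemma summable_powW (R : realType) (V W : normedModType R) (r : R)
    (u : nat -> V) (v : nat -> W) : 0 < r -> r <= 1 -> summable_pow r u v ->
  cvgn (series (fun n => `|u n| * `|v n|)).
Proof.
move=> r0 r1 uv; apply: nneseries_lty_cvg; first by move=> n; rewrite mulr_ge0.
pose t n := `|u n| * `|v n|.
have t0 n : 0 <= t n by rewrite mulr_ge0.
have trE n : `|u n| `^ r * `|v n| `^ r = t n `^ r by rewrite powRM.
pose M := fine (\sum_(0 <= n <oo) (`|u n| `^ r * `|v n| `^ r)%:E)%E.
have s0 : forall n, (0 <= n)%N -> true -> (0 <= (`|u n| `^ r * `|v n| `^ r)%:E)%E.
  by move=> n _ _; rewrite lee_fin mulr_ge0 ?powR_ge0.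
have M0 : 0 <= M by rewrite fine_ge0// nneseries_ge0.
have tM n : t n `^ r <= M.
  rewrite -lee_fin /M fineK ?ge0_fin_numE ?nneseries_ge0//.
  apply: le_trans (nneseries_lim_ge n.+1 s0).
  by rewrite big_nat_recr//= trE leeDr// sume_ge0// => k _; exact: s0.
pose B := M `^ r^-1.
have tB n : t n <= B.
  rewrite -[leLHS](powRr1 (t0 n)) -(@divff _ r) ?gt_eqF// powRrM.
  by apply: ge0_ler_powR; rewrite ?nnegrE ?invr_ge0 ?powR_ge0// ltW.
apply: (@le_lt_trans _ _ (\sum_(0 <= n <oo)
    (B `^ (1 - r))%:E * (`|u n| `^ r * `|v n| `^ r)%:E)%E).
  apply: lee_nneseries => [n _ _|n _]; first by rewrite lee_fin.
  rewrite -/(t n) trE -EFinM lee_fin.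
  have [->|tn0] := eqVneq (t n) 0; first by rewrite mulr_ge0 ?powR_ge0.
  rewrite -[leLHS](powRr1 (t0 n)) -[X in _ `^ X](subrK r 1) powRD; last first.
    by rewrite tn0 implybT.
  rewrite ler_wpM2r ?powR_ge0// ge0_ler_powR ?nnegrE ?subr_ge0//.
  exact: powR_ge0.
rewrite nneseriesZl; last by move=> n _; exact: s0.
by apply: lte_mul_pinfty => //; rewrite lee_fin powR_ge0.
Qed.

Lemma summable_powC (R : realType) (V W : normedModType R) (r : R)
    (u : nat -> V) (v : nat -> W) : summable_pow r u v -> summable_pow r v u.
Proof. by rewrite /summable_pow; under eq_eseriesr do rewrite mulrC. Qed.

Lemma summable_pow1 (R : realType) (V W : normedModType R)
    (u : nat -> V) (v : nat -> W) :
  cvgn (series (fun n => `|u n| * `|v n|)) -> summable_pow 1 u v.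
Proof.
move=> uv; rewrite /summable_pow; under eq_eseriesr do rewrite !powRr1//.
by apply: cvg_nneseries_lty => // n; rewrite mulr_ge0.
Qed.

(** * Integral kernels of nuclear operators *)

Section kernel.
Context {d d'} {Omega : measurableType d} {Xi : measurableType d'} {R : realType}.
Variables (mu : {sigma_finite_measure set Omega -> \bar R})
  (nu : {sigma_finite_measure set Xi -> \bar R}).
Hypothesis mu_complete : measure_is_complete mu.
Variables (p : vexponent Omega R) (q : vexponent Xi R).
Variables (g : nat -> vLspace nu q) (h : nat -> vLspace mu (vexp_conj p)).
Hypothesis gh : cvgn (series (fun n => `|g n| * `|h n|)).

Let gh_lty (C : R) : 0 <= C ->
  (\sum_(0 <= n <oo) (C * (`|g n| * `|h n|))%:E < +oo)%E.
Proof.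
move=> C0; under eq_eseriesr do rewrite EFinM.
rewrite nneseriesZl; last by move=> *; rewrite lee_fin mulr_ge0.
apply: lte_mul_pinfty => //; exact: cvg_nneseries_lty.
Qed.

Lemma pairing_coef_summable (f : vLspace mu p) :
  cvgn (series (fun n => `|lp_pairing f (h n)| * `|g n|)).
Proof.
apply: nneseries_lty_cvg; first by move=> n; rewrite mulr_ge0.
have c0 : 0 <= 2 * `|f| by rewrite mulr_ge0.
apply: le_lt_trans (gh_lty c0); apply: lee_nneseries => [n _ _|n _].
  by rewrite lee_fin mulr_ge0.
rewrite lee_fin (mulrC `|g n|) mulrA ler_wpM2r// -mulrA.
exact: lp_pairing_le.
Qed.

(** The exceptional null set is that of [sum_n |h_n| |g_n(x)|]; in particular
    it does not depend on [f]. *)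
Lemma kernel_ae : \forall x \ae nu,
  (\forall y \ae mu, cvgn (series (fun n => g n x * h n y))) /\
  forall f : vLspace mu p,
    mu.-integrable [set: Omega] (fun y => (kernel_sum g h x y * f y)%:E) /\
    series (fun n => lp_pairing f (h n) * g n x) @ \oo -->
      \int[mu]_y (kernel_sum g h x y * f y).
Proof.
have : \forall x \ae nu, (\sum_(0 <= n <oo) `|(`|h n| * g n x)%:E| < +oo)%E.
  apply: vL_abs_summable_ae; apply: le_lt_trans (gh_lty ler01).
  apply: lee_nneseries => [n _ _|n _]; first by rewrite lee_fin mulr_ge0.
  by rewrite mul1r normr_id mulrC.
apply: filterS => x gx.
have cy : \forall y \ae mu, cvgn (series (fun n => g n x * h n y)).
  have : \forall y \ae mu, (\sum_(0 <= n <oo) `|(g n x * h n y)%:E| < +oo)%E.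
    apply: vL_abs_summable_ae; apply: le_lt_trans gx.
    apply: lee_nneseries => [n _ _|n _]; first by rewrite lee_fin mulr_ge0.
    by rewrite abse_EFin normrM normr_id mulrC.
  by apply: filterS => y; exact: abs_summable_cvg.
split => // f.
have mF n : measurable_fun setT (fun y => g n x * (f y * h n y)).
  by apply: (@measurable_funM _ _ _ _ (cst _)) => //; exact: vL_mul_measurable.
have Fy : (\sum_(0 <= n <oo) \int[mu]_y `|(g n x * (f y * h n y))%:E| < +oo)%E.
  apply: (@le_lt_trans _ _ (\sum_(0 <= n <oo) (2 * `|f|)%:E * `|(`|h n| * g n x)%:E|)%E).
    apply: lee_nneseries => [n _ _|n _]; first exact: integral_ge0.
    under eq_integral do rewrite EFinM abseM.
    rewrite ge0_integralZl//; last first.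
      apply: measurableT_comp => //; apply/measurable_EFinP; exact: vL_mul_measurable.
    rewrite [leRHS](_ : _ = (`|g n x|%:E * (2 * (`|f| * `|h n|))%:E)%E).
      by apply: lee_pmul => //; [exact: integral_ge0|exact: vL_hoelder].
    by rewrite abse_EFin -!EFinM normrM normr_id; congr EFin; ring.
  rewrite nneseriesZl; last by move=> *; exact: abse_ge0.
  by apply: lte_mul_pinfty => //; rewrite lee_fin mulr_ge0.
have Fk : \forall y \ae mu, series (fun n => g n x * (f y * h n y)) @ \oo -->
    kernel_sum g h x y * f y.
  apply: filterS cy => y cy.
  rewrite (_ : series _ = (fun n => series (fun n => g n x * h n y) n * f y)).
    by apply: cvgM; [exact: cy|exact: cvg_cst].
  apply/funext => n; rewrite /series/= mulr_suml; apply: eq_bigr => k _; ring.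
have [ik ck] := cvg_series_integral mu_complete mF Fy Fk.
split; first exact: ik.
rewrite (_ : (fun n => lp_pairing f (h n) * g n x) =
  (fun n => \int[mu]_y (g n x * (f y * h n y)))); first exact: ck.
apply/funext => n; rewrite [RHS]RintegralZl; [|by []|exact: vL_mul_integrable].
by rewrite mulrC.
Qed.

Lemma kernel_rep_series (T : vLspace mu p -> vLspace nu q) :
  (forall f, series (fun n => lp_pairing f (h n) *: g n) @ \oo --> T f) ->
  kernel_rep T g h.
Proof.
move=> Tf f.
have cg : \forall x \ae nu, cvgn (series (fun n => lp_pairing f (h n) * g n x)).
  by apply: filterS kernel_ae => x [_ /(_ f)[_ c]]; apply: cvgP c.
apply: filterS2 kernel_ae (vL_series_cvg_ae (Tf f) cg) => x [c kf] Tfx.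
have [ik ck] := kf f; split => //.
exact: (cvg_unique _ Tfx ck).
Qed.

Lemma series_kernel_rep (T : vLspace mu p -> vLspace nu q) (f : vLspace mu p) :
  kernel_rep T g h -> series (fun n => lp_pairing f (h n) *: g n) @ \oo --> T f.
Proof.
move=> /(_ f) Tf; apply: vL_series_cvg; first exact: pairing_coef_summable.
by apply: filterS2 kernel_ae Tf => x [_ /(_ f)[_ c]] [_ _ ->].
Qed.

Lemma linear_series (T : vLspace mu p -> vLspace nu q) :
  (forall f, series (fun n => lp_pairing f (h n) *: g n) @ \oo --> T f) -> linear T.
Proof.
move=> Tf a f1 f2; apply: (cvg_unique (@norm_hausdorff _ _) (Tf _)).
rewrite (_ : series _ = (fun n => a *: series (fun n => lp_pairing f1 (h n) *: g n) n +
    series (fun n => lp_pairing f2 (h n) *: g n) n)).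
  by apply: cvgD => //; exact: cvgZl_tmp.
apply/funext => n; rewrite /series/= scaler_sumr -big_split/=.
by apply: eq_bigr => k _; rewrite lp_pairingDl lp_pairingZl scalerDl scalerA.
Qed.

End kernel.

Section diagonal.
Context {d} {T : measurableType d} {R : realType}.
Variables (mu : {measure set T -> \bar R}) (p : vexponent T R).
Hypothesis mu_complete : measure_is_complete mu.
Variables (g : nat -> vLspace mu p) (h : nat -> vLspace mu (vexp_conj p)).
Hypothesis gh : cvgn (series (fun n => `|g n| * `|h n|)).

Lemma kernel_diagonal :
  [/\ \forall x \ae mu, cvgn (series (fun n => g n x * h n x)),
      mu.-integrable [set: T] (fun x => (kernel_sum g h x x)%:E) &
      series (fun n => lp_pairing (g n) (h n)) @ \oo -->
        \int[mu]_x kernel_sum g h x x].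
Proof.
have Fy : (\sum_(0 <= n <oo) \int[mu]_x `|(g n x * h n x)%:E| < +oo)%E.
  apply: (@le_lt_trans _ _ (\sum_(0 <= n <oo) 2%:E * (`|g n| * `|h n|)%:E)%E).
    apply: lee_nneseries => [n _ _|n _]; first exact: integral_ge0.
    by rewrite -EFinM; exact: vL_hoelder.
  rewrite nneseriesZl; last by move=> *; rewrite lee_fin mulr_ge0.
  apply: lte_mul_pinfty => //; exact: cvg_nneseries_lty.
have mF n := vL_mul_measurable (g n) (h n).
have cx : \forall x \ae mu, cvgn (series (fun n => g n x * h n x)).
  by apply: filterS (ae_summable mF Fy) => x; exact: abs_summable_cvg.
by have [] := cvg_series_integral mu_complete mF Fy cx.
Qed.

End diagonal.

(** * Averages over one cell *)

Section powR_facts.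
Context {R : realType}.

(** [|ln b| <= k ln 4] and [|t| <= 1/k], so [t ln b >= - ln 4]. *)
Lemma powR_small_exponent (b t : R) (k : nat) :
  4 ^- k <= b -> b <= 4 ^+ k -> `|t| * k%:R <= 1 -> 4^-1 <= b `^ t.
Proof.
move=> bk kb tk.
have k0 : 0 < 4 ^- k :> R by rewrite invr_gt0 exprn_gt0.
have b0 : 0 < b by exact: lt_le_trans bk.
have l4 : 0 <= ln 4 :> R by rewrite ln_ge0// ler1n.
have lb : `|ln b| <= k%:R * ln 4.
  have h1 : ln b <= ln (4 ^+ k) by rewrite ler_ln// posrE// exprn_gt0.
  have h2 : ln (4 ^- k) <= ln b by rewrite ler_ln.
  move: h1 h2; rewrite lnV ?posrE ?exprn_gt0// lnXn// mulr_natl => h1 h2.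
  by rewrite ler_norml h2 h1.
rewrite /powR gt_eqF// -[leLHS](@lnK R) ?posrE ?invr_gt0//.
rewrite ler_expR lnV ?posrE// lerNl -mulNr.
apply: (le_trans (ler_norm _)); rewrite normrM normrN.
apply: le_trans (_ : `|t| * (k%:R * ln 4) <= _); first by rewrite ler_wpM2l.
by rewrite mulrA ler_piMl.
Qed.

(** From [b < 2 u] one gets [b^(s-1) <= 2^P u^(s-1)]; replacing the exponent
    [s] of [b] by [t] costs a factor 4 by [powR_small_exponent]. *)
Lemma le_powR_cross (u b s t P : R) (k : nat) : 0 < b -> b < 2 * u ->
  1 <= s -> s <= P -> `|s - t| * k%:R <= 1 ->
  4 ^- k <= b -> b <= 4 ^+ k ->
  u <= 4 * 2 `^ P * (u `^ s * b `^ (1 - t)).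
Proof.
move=> b0 bu s1 sP stk bk kb.
have u0 : 0 < u by rewrite -(pmulr_rgt0 _ (ltr0n R 2)) (lt_trans b0).
have h4 := powR_small_exponent bk kb stk.
have hb : b `^ (s - 1) <= 2 `^ P * u `^ (s - 1).
  apply: (@le_trans _ _ ((2 * u) `^ (s - 1))).
    by apply: ge0_ler_powR; rewrite ?nnegrE ?subr_ge0// ltW// mulr_gt0.
  rewrite powRM// ?(ltW u0)//; apply: ler_wpM2r; first exact: powR_ge0.
  by apply: ler_powR; [rewrite ler1n|lra].
have us : u `^ s = u * u `^ (s - 1) by rewrite mulr_powRB1 ?(ltW u0)//; lra.
have bst : b `^ (s - t) = b `^ (s - 1) * b `^ (1 - t).
  by rewrite -powRD ?(gt_eqF b0) ?implybT//; congr powR; lra.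
have : 1 <= 4 * (2 `^ P * u `^ (s - 1) * b `^ (1 - t)).
  have : b `^ (s - 1) * b `^ (1 - t) <= 2 `^ P * u `^ (s - 1) * b `^ (1 - t).
    by apply: ler_wpM2r => //; exact: powR_ge0.
  by rewrite -bst; lra.
rewrite us.
rewrite (_ : 4 * 2 `^ P * (u * u `^ (s - 1) * b `^ (1 - t)) =
   u * (4 * (2 `^ P * u `^ (s - 1) * b `^ (1 - t)))); last by ring.
by move=> h; rewrite ler_peMr// ltW.
Qed.

End powR_facts.

Section cell.
Context {d} {T : measurableType d} {R : realType}.
Variables (mu : {measure set T -> \bar R}) (p : vexponent T R).
Variables (k : nat) (P : R).
Hypothesis k0 : (0 < k)%N.
Variable E : set T.
Hypothesis mE : measurable E.
Hypothesis Efin : (mu E < +oo)%E.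
Hypothesis Ebig : ((2 ^- k)%:E <= mu E)%E.
Hypothesis pP : forall x, E x -> (p x <= P%:E)%E.
Hypothesis posc : forall x y, E x -> E y -> `|fine (p x) - fine (p y)| * k%:R <= 1.
Variables f h : T -> R.
Hypotheses (mf : measurable_fun setT f) (mh : measurable_fun setT h).
Hypothesis fE : mu.-integrable E (EFin \o f).
Hypothesis hE : mu.-integrable E (EFin \o h).
Hypothesis f1 : (modular mu p f <= 1)%E.

Let m := fine (mu E).
Let eta : R := 2 ^- k.
Let b := m^-1 * \int[mu]_(x in E) `|f x|.
Let A x := `|f x| `^ fine (p x).
Let a := \int[mu]_(x in E) A x.

Let eta0 : 0 < eta. Proof. by rewrite invr_gt0 exprn_gt0. Qed.
Let mfin : mu E = m%:E.
Proof. by rewrite /m fineK// ge0_fin_numE. Qed.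
Let meta : eta <= m. Proof. by rewrite -lee_fin -mfin. Qed.
Let m0 : 0 < m. Proof. exact: lt_le_trans meta. Qed.

Let fp x : E x -> p x = (fine (p x))%:E.
Proof.
move=> /pP px; rewrite fineK// fin_numE.
rewrite gt_eqF; last by rewrite (lt_le_trans _ (vexp_ge1 p x))// ltNye.
by rewrite lt_eqF// (le_lt_trans px)// ltry.
Qed.

Let p1 x : E x -> 1 <= fine (p x).
Proof. by move=> Ex; rewrite -lee_fin -fp// vexp_ge1. Qed.

Let pP' x : E x -> fine (p x) <= P.
Proof. by move=> Ex; rewrite -lee_fin -fp// pP. Qed.

Let AE x : E x -> (A x)%:E = epow `|f x| (p x).
Proof. by move=> Ex; rewrite fp. Qed.

Let mA : measurable_fun E (EFin \o A).
Proof.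
apply: (eq_measurable_fun (fun x => epow `|f x| (p x))).
  by move=> x /set_mem Ex; rewrite /= AE.
by apply: measurable_funTS; exact: measurable_modular.
Qed.

Let intA : (\int[mu]_(x in E) (A x)%:E = \int[mu]_(x in E) epow `|f x| (p x))%E.
Proof. by apply: eq_integral => x /set_mem Ex; exact: AE. Qed.

Let intA1 : (\int[mu]_(x in E) (A x)%:E <= 1)%E.
Proof.
rewrite intA; apply: le_trans f1; apply: ge0_subset_integral => //.
- exact: measurable_modular.
- by move=> x _; exact: epow_ge0.
Qed.

Let intA0 : (0 <= \int[mu]_(x in E) (A x)%:E)%E.
Proof. by apply: integral_ge0 => x _; rewrite lee_fin powR_ge0. Qed.

Let iA : mu.-integrable E (EFin \o A).
Proof.
apply/integrableP; split => //; apply: (@le_lt_trans _ _ 1%E); last exact: ltry.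
apply: le_trans intA1; rewrite le_eqVlt; apply/orP; left; apply/eqP.
by apply: eq_integral => x _; rewrite gee0_abs// lee_fin powR_ge0.
Qed.

Let aE : a%:E = (\int[mu]_(x in E) (A x)%:E)%E.
Proof. by rewrite /a fineK//; exact: integrable_fin_num. Qed.

Let a0 : 0 <= a. Proof. by rewrite -lee_fin aE. Qed.
Let a1 : a <= 1. Proof. by rewrite -lee_fin aE. Qed.

Let nfE : mu.-integrable E (EFin \o (fun x => `|f x|)).
Proof. exact: integrable_norm. Qed.

Let b0 : 0 <= b.
Proof. by rewrite mulr_ge0 ?invr_ge0 ?(ltW m0)//; exact: Rintegral_ge0. Qed.

Let mb : m * b = \int[mu]_(x in E) `|f x|.
Proof. by rewrite /b mulrA divff ?mul1r// gt_eqF. Qed.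

Let icst (c : R) : mu.-integrable E (EFin \o cst c).
Proof.
apply/integrableP; split; first exact/measurable_EFinP.
rewrite (_ : (\int[mu]_(x in E) _)%E = (\int[mu]_(x in E) cst `|c|%:E x)%E)//.
by rewrite integral_cst// mfin -EFinM ltry.
Qed.

Let intD (c c' : R) : \int[mu]_(x in E) (c + c' * A x) = c * m + c' * a.
Proof.
rewrite RintegralD//; [|exact: icst|exact: (integrableZl mE c' iA)].
by rewrite Rintegral_cst// RintegralZl.
Qed.

Let iD (c c' : R) : mu.-integrable E (EFin \o (fun x => c + c' * A x)).
Proof. exact: (integrableD mE (icst c) (integrableZl mE c' iA)). Qed.

Let b_upper : b <= 4 ^+ k.
Proof.
have mba : m * b <= m + a.
  rewrite mb -[m in leRHS]mul1r -[a in leRHS]mul1r -intD.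
  apply: le_Rintegral => // x Ex; rewrite mul1r.
  have [fx1|/ltW fx1] := leP `|f x| 1.
    by rewrite ler_wpDr// powR_ge0.
  by rewrite ler_wpDl// le1r_powR// p1.
have z2 : 2 <= (2 ^+ k : R) by case: k k0 => // j _; rewrite exprS ler_peMr// exprn_ege1// ler1n.
have zeta : (2 ^+ k : R) * eta = 1 by rewrite divff// gt_eqF// exprn_gt0.
have -> : (4 : R) = 2 * 2 by ring.
rewrite exprMn; set z := (2 ^+ k : R) in z2 zeta *.
have zm : 1 <= z * m by rewrite -zeta ler_wpM2l//; lra.
have : m * b <= m * (1 + z) by have := a1; lra.
by rewrite ler_pM2l//; nra.
Qed.

(** If [b], the average of [|f|], is at most [2 eta] with [eta = 2^-k], then
    [b^p(y) <= b]. Else [|f x| <= b/2 + K |f x|^p(x) b^(1-p(y))] for all [x] in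
    the cell; after integration in [x] the term [b/2] is absorbed on the left,
    and what remains is [m b^p(y) <= 2 K int |f|^p]. The bounds
    [2^-k <= mu(E)] and [modular f <= 1] keep [b] between [4^-k] and [4^k]. *)
Lemma cell_powR_le y : E y ->
  b `^ fine (p y) <= 2 * 2 ^- k + 8 * 2 `^ P * a / m.
Proof.
move=> Ey; rewrite -/eta.
have K0 : 0 <= 2 `^ P :> R by exact: powR_ge0.
have Ca0 : 0 <= 8 * 2 `^ P * a / m by rewrite !mulr_ge0// invr_ge0 ltW.
have eta2 : 2 * eta <= 1.
  rewrite /eta; case: k k0 => // j _; rewrite exprS invfM mulrA divff// mul1r.
  by rewrite invf_le1 ?exprn_gt0// exprn_ege1// ler1n.
have [bs|bb] := leP b (2 * eta).
  apply: le_trans (_ : b <= _); last by rewrite (le_trans bs)// lerDl.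
  have [b00|bn0] := eqVneq b 0.
    by rewrite b00 powR0// gt_eqF// (lt_le_trans ltr01)// p1.
  apply: ge1r_powR; last exact: p1.
  by rewrite lt0r bn0 b0/= (le_trans bs).
have bp : 0 < b by rewrite (lt_trans _ bb)// mulr_gt0.
have b_lower : 4 ^- k <= b.
  apply: (@le_trans _ _ eta); last by rewrite ltW// (lt_trans _ bb)// ltr_pMl// ltr1n.
  by rewrite /eta lef_pV2 ?posrE ?exprn_gt0// lerXn2r ?nnegrE// ler_nat.
set w := b `^ (1 - fine (p y)).
have w0 : 0 <= w by exact: powR_ge0.
have hx x : E x -> `|f x| <= b / 2 + 4 * 2 `^ P * w * A x.
  move=> Ex; have [fb|fb] := leP `|f x| (b / 2).
    by rewrite ler_wpDr// mulr_ge0 ?powR_ge0// mulr_ge0// mulr_ge0.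
  apply: ler_wpDl; first by rewrite divr_ge0.
  have b2 : b < 2 * `|f x| by rewrite mulrC -ltr_pdivrMr.
  have := le_powR_cross bp b2 (p1 Ex) (pP' Ex) (posc Ex Ey) b_lower b_upper.
  by rewrite -/w (mulrC _ w) mulrA.
have mbw : m * b <= b / 2 * m + 4 * 2 `^ P * w * a.
  by rewrite mb -intD; exact: le_Rintegral.
have wb : w * b `^ fine (p y) = b.
  by rewrite /w -powRD ?(gt_eqF bp) ?implybT// subrK powRr1.
have h2 : w * (m * b `^ fine (p y)) <= w * (8 * 2 `^ P * a).
  by rewrite mulrCA wb; lra.
have w1 : 0 < w by exact: powR_gt0.
rewrite ler_pM2l// in h2.
apply: ler_wpDl; first by rewrite mulr_ge0// ltW.
by rewrite ler_pdivlMr// mulrC.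
Qed.

(** Young's inequality for the constant [b] and [h y], with the exponent
    [p(y)], integrated over the cell. *)
Lemma cell_le :
  ((m^-1 * \int[mu]_(x in E) `|f x| * \int[mu]_(x in E) `|h x|)%:E <=
   (2 * 2 ^- k)%:E * mu E
   + (8 * 2 `^ P)%:E * \int[mu]_(x in E) epow `|f x| (p x)
   + \int[mu]_(x in E) epow `|h x| (vexp_conj p x))%E.
Proof.
have -> : ((m^-1 * \int[mu]_(x in E) `|f x| * \int[mu]_(x in E) `|h x|)%:E =
    \int[mu]_(x in E) (b * `|h x|)%:E)%E.
  rewrite -/b -RintegralZl//; last exact: integrable_norm.
  rewrite fineK//; apply: integrable_fin_num => //.
  exact: (integrableZl mE b (integrable_norm hE)).
pose c := 2 * 2 ^- k + 8 * 2 `^ P * a / m.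
have c0 : 0 <= c.
  by rewrite addr_ge0// ?mulr_ge0 ?invr_ge0 ?exprn_ge0 ?powR_ge0// ltW.
apply: (@le_trans _ _ (\int[mu]_(x in E) (c%:E + epow `|h x| (vexp_conj p x)))%E).
  have mH : measurable_fun E (fun x => epow `|h x| (vexp_conj p x)).
    by apply: measurable_funTS; exact: measurable_modular.
  apply: ge0_le_integral => //.
  - by move=> x _; rewrite lee_fin mulr_ge0.
  - apply/measurable_EFinP; apply: measurable_funM => //.
    by apply: measurable_funTS; exact: measurableT_comp.
  - exact: emeasurable_funD.
  move=> x Ex; apply: le_trans (epow_young b0 (normr_ge0 (h x)) (vexp_ge1 p x)) _.
  by apply: leeD => //; rewrite (fp Ex)/= lee_fin cell_powR_le.
rewrite ge0_integralD//; last 2 first.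
- by move=> x _; exact: epow_ge0.
- by apply: measurable_funTS; exact: measurable_modular.
apply: leeD => //; rewrite integral_cst// -intA -aE mfin -!EFinM -EFinD lee_fin.
by rewrite /c mulrDl lerD2l// divfK// gt_eqF.
Qed.

End cell.

(** * Averages over a family of cells *)

Section averaging.
Context {d} {T : measurableType d} {R : realType}.
Variables (mu : {measure set T -> \bar R}).

Lemma vL_integrable_on (p : vexponent T R) (D : set T) (g : vLspace mu p) :
  measurable D -> (mu D < +oo)%E -> mu.-integrable D (EFin \o g).
Proof.
move=> mD Dy; have [K _ /(_ g) gK] := vL_local_bound p mD Dy.
apply/(integrable_mkcond _ mD); apply/integrableP; split.
  apply/(measurable_restrictT _ mD)/measurable_EFinP.
  by apply: measurable_funTS; exact: vL_measurable.
apply: le_lt_trans (ltry _); apply: le_trans gK.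
rewrite le_eqVlt; apply/orP; left; apply/eqP; apply: eq_integral => x _.
rewrite patchE indicE; case: (x \in D); first by rewrite mulr1.
by rewrite mulr0.
Qed.

Section cells.
Variables (C : finType) (E : C -> set T).
Hypothesis mE : forall c, measurable (E c).
Hypothesis tE : trivIset setT E.

Let U := \big[setU/set0]_(c <- enum C) E c.

Let mU : measurable U. Proof. exact: bigsetU_measurable. Qed.

Let tE' : trivIset [set` enum C] E.
Proof. exact: sub_trivIset tE. Qed.

Lemma bigsetU_enumE : U = \bigcup_c E c.
Proof.
rewrite /U -bigcup_seq; apply/seteqP; split => x [c _ ?]; exists c => //=.
by rewrite mem_enum.
Qed.

Lemma sum_integral_le (F : T -> \bar R) :
  measurable_fun setT F -> (forall x, 0 <= F x)%E ->
  (\sum_c \int[mu]_(x in E c) F x <= \int[mu]_x F x)%E.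
Proof.
move=> mF F0; rewrite -big_enum -ge0_integral_bigsetU//.
- exact: ge0_subset_integral.
- exact: enum_uniq.
- exact: measurable_funTS.
Qed.

(** The pairing of [h] with the finite rank operator that replaces [f] by its
    average on each cell. A cell of measure 0 contributes 0, since [0^-1 = 0]. *)
Definition avg_form (f h : T -> R) : R :=
  \sum_c (fine (mu (E c)))^-1 * (\int[mu]_(x in E c) f x) * \int[mu]_(x in E c) h x.

Section bound.
Variables (p : vexponent T R) (k : nat) (P : R).
Hypothesis k0 : (0 < k)%N.
Hypothesis Efin : forall c, (mu (E c) < +oo)%E.
Hypothesis Ebig : forall c, E c = set0 \/ ((2 ^- k)%:E <= mu (E c))%E.
Hypothesis Esum : (\sum_c mu (E c) <= (2 ^+ k)%:E)%E.
Hypothesis pP : forall c x, E c x -> (p x <= P%:E)%E.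
Hypothesis posc : forall c x y, E c x -> E c y ->
  `|fine (p x) - fine (p y)| * k%:R <= 1.

(** Summing [cell_le]: the terms [2 2^-k mu(E_c)] add up to at most 2, the
    integrals of [|f|^p] and [|h|^p'] to at most 1. *)
Lemma avg_form_modular_le (f h : T -> R) :
  measurable_fun setT f -> measurable_fun setT h ->
  (forall c, mu.-integrable (E c) (EFin \o f)) ->
  (forall c, mu.-integrable (E c) (EFin \o h)) ->
  (modular mu p f <= 1)%E -> (modular mu (vexp_conj p) h <= 1)%E ->
  `|avg_form f h| <= 3 + 8 * 2 `^ P.
Proof.
move=> mf mh fE hE f1 h1.
have K0 : 0 <= 8 * 2 `^ P :> R by rewrite mulr_ge0// powR_ge0.
have If0 c : (0 <= \int[mu]_(x in E c) epow `|f x| (p x))%E.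
  by apply: integral_ge0 => x _; exact: epow_ge0.
have Ih0 c : (0 <= \int[mu]_(x in E c) epow `|h x| (vexp_conj p x))%E.
  by apply: integral_ge0 => x _; exact: epow_ge0.
apply: (le_trans (ler_norm_sum _ _ _)).
rewrite -lee_fin -sumEFin.
apply: (@le_trans _ _ (\sum_c ((2 * 2 ^- k)%:E * mu (E c)
   + (8 * 2 `^ P)%:E * \int[mu]_(x in E c) epow `|f x| (p x)
   + \int[mu]_(x in E c) epow `|h x| (vexp_conj p x)))%E).
  apply: lee_sum => c _.
  have [E0|Ec] := Ebig c.
    rewrite E0 !Rintegral_set0 !mulr0 normr0 measure0 mule0 add0e.
    by rewrite !integral_set0 mule0 add0e.
  apply: le_trans (cell_le k0 (mE c) (Efin c) Ec (@pP c) (@posc c) mf mh (fE c) (hE c) f1).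
  rewrite lee_fin !normrM ger0_norm ?invr_ge0 ?fine_ge0//.
  rewrite -!mulrA ler_wpM2l ?invr_ge0 ?fine_ge0//.
  by apply: ler_pM => //; exact: le_normr_Rintegral.
rewrite 2!big_split/= -!ge0_sume_distrr//.
have -> : ((3 + 8 * 2 `^ P)%:E = (2 * 2 ^- k)%:E * (2 ^+ k)%:E + (8 * 2 `^ P)%:E * 1 + 1)%E.
  rewrite mule1 -EFinM -!EFinD; congr EFin.
  by rewrite -mulrA mulVf ?gt_eqF ?exprn_gt0//; ring.
apply: leeD; first apply: leeD.
- by apply: lee_pmul => //; rewrite ?lee_fin ?mulr_ge0 ?invr_ge0 ?exprn_ge0// sume_ge0.
- apply: lee_pmul => //; [exact: sume_ge0|apply: le_trans f1].
  by apply: (@sum_integral_le (fun x => epow `|f x| (p x))) => [|x];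
    [exact: measurable_modular|exact: epow_ge0].
- apply: le_trans h1.
  by apply: (@sum_integral_le (fun x => epow `|h x| (vexp_conj p x))) => [|x];
    [exact: (measurable_modular (vexp_conj p))|exact: epow_ge0].
Qed.

(** The constant depends neither on the number of cells nor on [k]. *)
Lemma avg_form_le (f : vLspace mu p) (h : vLspace mu (vexp_conj p)) :
  `|avg_form f h| <= (3 + 8 * 2 `^ P) * (`|f| * `|h|).
Proof.
apply: le_bilinear_limit => // a b fa hb.
have [a0 fa1] := vL_lux_set fa.
have [b0 hb1] := vL_lux_set hb.
have fE c : mu.-integrable (E c) (EFin \o f) by exact: vL_integrable_on.
have hE c : mu.-integrable (E c) (EFin \o h) by exact: vL_integrable_on.
have := @avg_form_modular_le (fun x => f x / a) (fun x => h x / b).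
have -> : avg_form (fun x => f x / a) (fun x => h x / b) = avg_form f h / (a * b).
  rewrite /avg_form mulr_suml; apply: eq_bigr => c _.
  by rewrite !RintegralZr// invfM; ring.
rewrite normrM normfV (gtr0_norm (mulr_gt0 a0 b0)) ler_pdivrMr ?mulr_gt0//.
apply => //.
- by apply: measurable_fun_divr; exact: vL_measurable.
- by apply: measurable_fun_divr; exact: vL_measurable.
- move=> c; have := integrableZr (mE c) a^-1 (fE c).
  by apply: eq_integrable => // x _; rewrite /= EFinM.
- move=> c; have := integrableZr (mE c) b^-1 (hE c).
  by apply: eq_integrable => // x _; rewrite /= EFinM.
Qed.

End bound.

Lemma avg_form_approx (f h : T -> R) (theta : R) :
  (forall c, mu (E c) < +oo)%E ->
  (forall c, mu.-integrable (E c) (EFin \o f)) ->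
  mu.-integrable U (EFin \o h) ->
  mu.-integrable setT (fun x => (f x * h x)%:E) ->
  (forall c x y, E c x -> E c y -> `|f x - f y| <= theta) ->
  `|avg_form f h - \int[mu]_x (f x * h x)| <=
    theta * (\int[mu]_(x in U) `|h x|) + \int[mu]_(x in ~` U) `|f x * h x|.
Proof.
move=> Efin fE hU fh osc.
have sub c : E c `<=` U by rewrite bigsetU_enumE => x Ex; exists c.
have hE c : mu.-integrable (E c) (EFin \o h) by apply: integrableS hU.
have fhE D : measurable D -> mu.-integrable D (EFin \o (fun x => f x * h x)).
  by move=> mD; apply: integrableS fh.
have sumU (F : T -> R) : mu.-integrable U (EFin \o F) ->
    \int[mu]_(x in U) F x = \sum_c \int[mu]_(x in E c) F x.
  move=> iF; rewrite /Rintegral integral_bigsetU_EFin//.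
  - rewrite -[RHS]big_enum -sum_fine// => c _.
    by apply: integrable_fin_num => //; apply: integrableS iF.
  - exact: enum_uniq.
  - exact: measurable_int iF.
have -> : \int[mu]_x (f x * h x) =
    \int[mu]_(x in U) (f x * h x) + \int[mu]_(x in ~` U) (f x * h x).
  rewrite -Rintegral_setU ?setUv//; first exact: measurableC.
  by apply/disj_setPCl.
rewrite opprD addrA; apply: le_trans (ler_normB _ _) _.
have mCU : measurable (~` U) by exact: measurableC.
apply: lerD; last by apply: le_normr_Rintegral => //; exact: fhE.
rewrite sumU; last exact: fhE.
rewrite sumU; last exact: integrable_norm.
rewrite /avg_form -sumrB mulr_sumr; apply: (le_trans (ler_norm_sum _ _ _)).
apply: ler_sum => c _.
have [m0|m0] := eqVneq (mu (E c)) 0%E.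
  have z F : mu.-integrable (E c) (EFin \o F) -> \int[mu]_(x in E c) F x = 0.
    move=> iF; rewrite /Rintegral null_set_integral//.
    exact: measurable_int iF.
  rewrite (z _ (hE c)) (z _ (fhE _ (mE c))) (z _ (integrable_norm (hE c))).
  by rewrite !mulr0 subrr normr0.
set m := fine (mu (E c)).
have mfin : mu (E c) = m%:E by rewrite /m fineK// ge0_fin_numE.
have mp : 0 < m by rewrite -lte_fin -mfin lt0e m0/=.
set I := \int[mu]_(x in E c) f x.
rewrite -(RintegralZl (m^-1 * I) (mE c) (hE c)) -RintegralB//; last 2 first.
- exact: (integrableZl (mE c) (m^-1 * I) (hE c)).
- exact: fhE.
have iB : mu.-integrable (E c) (EFin \o (fun x => m^-1 * I * h x - f x * h x)).
  have := integrableB (mE c) (integrableZl (mE c) (m^-1 * I) (hE c)) (fhE _ (mE c)).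
  exact.
apply: (le_trans (le_normr_Rintegral (mE c) iB)).
rewrite -RintegralZl//; last exact: integrable_norm.
apply: le_Rintegral => //.
- exact: integrable_norm.
- exact: (integrableZl (mE c) theta (integrable_norm (hE c))).
move=> x Ex; rewrite -mulrBl normrM ler_wpM2r//.
(* [m^-1 I - f x] is itself an average, that of [y |-> f y - f x] *)
have icst r : mu.-integrable (E c) (EFin \o cst r).
  apply/integrableP; split; first exact/measurable_EFinP.
  rewrite (_ : (\int[mu]_(x in E c) _)%E = (\int[mu]_(x in E c) cst `|r|%:E x)%E)//.
  by rewrite integral_cst// mfin -EFinM ltry.
have -> : m^-1 * I - f x = m^-1 * \int[mu]_(y in E c) (f y - f x).
  rewrite RintegralB//; last exact: icst.
  by rewrite Rintegral_cst// -/m -/I mulrBr (mulrC (f x)) mulrA mulVf ?mul1r ?gt_eqF.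
have iBf : mu.-integrable (E c) (EFin \o (fun y => f y - f x)).
  exact: (integrableB (mE c) (fE c) (icst (f x))).
rewrite normrM (@ger0_norm _ m^-1) ?invr_ge0 ?(ltW mp)// mulrC ler_pdivrMr//.
apply: (le_trans (le_normr_Rintegral (mE c) iBf)).
rewrite -[leRHS](Rintegral_cst mu (mE c)); apply: le_Rintegral => //.
- exact: integrable_norm.
- exact: icst.
by move=> y Ey; exact: osc Ey Ex.
Qed.

End cells.
End averaging.

(** * Existence of good cells *)

Lemma exp2_dominates (R : realType) (Q : R) :
  exists2 k : nat, (0 < k)%N & Q * k%:R <= 2 ^+ k.
Proof.
(* take [k = 2 l] with [2 Q <= l < 2^l] *)
pose l := (Num.truncn (Num.max 0 (2 * Q))).+1.
have lQ : 2 * Q <= l%:R.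
  by rewrite ltW// (le_lt_trans _ (truncnS_gt _))// le_max lexx orbT.
exists (l + l)%N => //.
have l2 : l%:R <= 2 ^+ l :> R.
  by rewrite -natrX ler_nat ltnW// ltn_expl.
have l0 : 0 <= l%:R :> R by [].
rewrite exprD natrD; apply: (@le_trans _ _ (l%:R * l%:R)); last exact: ler_pM.
nra.
Qed.

Section cells_existence.
Context {d} {T : measurableType d} {R : realType}.

(** The sets are indexed by the values of [truncn ((u x + M) (j + 1))]. That
    their number is affine in [j] matters in [good_cells]. *)
Lemma level_sets (u : T -> R) (M j : nat) : measurable_fun setT u ->
  exists S : 'I_(2 * M * j.+1).+1 -> set T,
  [/\ forall c, measurable (S c),
      forall c c' x, S c x -> S c' x -> c = c',
      forall x, `|u x| <= M%:R -> exists c, S c x &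
      forall c x y, S c x -> S c y -> `|u x - u y| * j.+1%:R <= 1].
Proof.
move=> mfu; pose z x := (u x + M%:R) * j.+1%:R.
have mz : measurable_fun setT z.
  by apply: measurable_funM => //; exact: measurable_funD.
exists (fun c => [set x | c%:R <= z x < c.+1%:R]); split.
- move=> c; rewrite -[X in measurable X]setTI.
  have := mz measurableT _ (measurable_itv `[c%:R : R, c.+1%:R[).
  by congr (measurable (_ `&` _)); apply/seteqP; split => x /=; rewrite in_itv.
- move=> c c' x /= /andP[cz zc] /andP[cz' zc']; apply/val_inj/eqP => /=.
  have h1 := le_lt_trans cz zc'; have h2 := le_lt_trans cz' zc.
  by move: h1 h2; rewrite !ltr_nat !ltnS eqn_leq => -> ->.
- move=> x; rewrite ler_norml => /andP[ux xu].
  have z0 : 0 <= z x by rewrite mulr_ge0// -lerBlDr sub0r.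
  have /andP[z1 z2] := truncn_itv z0.
  have zM : (Num.truncn (z x) < (2 * M * j.+1).+1)%N.
    rewrite -(ltr_nat R) (le_lt_trans z1)// -natr1 !natrM.
    rewrite ltr_pwDr//.
    by rewrite ler_pM2r// mulr2n mulrDl !mul1r lerD2r.
  by exists (Ordinal zM) => /=; rewrite z1 z2.
- move=> c x y /= /andP[c1 c2] /andP[c3 c4].
  rewrite -(ger0_norm (ler0n R j.+1)) -normrM.
  rewrite (_ : (u x - u y) * _ = z x - z y); last by rewrite /z; ring.
  by move: c2 c4; rewrite -natr1 => c2 c4; rewrite ler_norml; apply/andP; split; lra.
Qed.

Lemma measure_bigsetU_le (mu : {measure set T -> \bar R}) (I : Type) (s : seq I)
    (F : I -> set T) : (forall i, measurable (F i)) ->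
  (mu (\big[setU/set0]_(i <- s) F i) <= \sum_(i <- s) mu (F i))%E.
Proof.
move=> mF; elim: s => [|i s IH]; first by rewrite !big_nil measure0.
rewrite !big_cons; apply: le_trans (measureU2 _ (mF i) _) _.
  exact: bigsetU_measurable.
exact: leeD2l.
Qed.

Section exhaust.
Variables (mu : {sigma_finite_measure set T -> \bar R}).
Variables (p : vexponent T R) (P : R).
Hypothesis pP : \forall x \ae mu, (p x <= P%:E)%E.
Variables (I : finType) (G : I -> T -> R).
Hypothesis mG : forall i, measurable_fun setT (G i).

(** Dominated convergence for [|w| 1_(~ A_n)], where the sets [A_n] increase
    to a set of full measure. *)
Lemma bounded_exhaustion (w : T -> R) (e : R) :
  mu.-integrable setT (EFin \o w) -> 0 < e ->
  exists (A : set T) (M : nat), [/\ measurable A, (mu A < +oo)%E,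
    (forall x, A x -> (p x <= P%:E)%E), (forall x i, A x -> `|G i x| <= M%:R) &
    (\int[mu]_(x in ~` A) `|(w x)%:E| <= e%:E)%E].
Proof.
move=> iw e0.
have /sigma_finiteP[F [FT Fnd Ffin]] := sigma_finiteT mu.
pose A n := F n `&` (p @^-1` [set y | (y <= P%:E)%E] `&`
  \bigcap_(i in [set: I]) (G i @^-1` [set y | `|y| <= n%:R])).
have mA n : measurable (A n).
  apply: measurableI; first by have [] := Ffin n.
  apply: measurableI.
    rewrite -[X in measurable X]setTI; apply: (measurable_vexp p) => //.
    by rewrite -set_itvNyc; exact: emeasurable_itv.
  apply: fin_bigcap_measurable => // i _; rewrite -[X in measurable X]setTI.
  apply: (mG i) => //.
  have := measurable_itv `[- n%:R : R, n%:R].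
  by congr measurable; apply/seteqP; split => x /=; rewrite in_itv/= ler_norml.
have mW n : measurable_fun setT (fun x => `|(w x)%:E| * (\1_(~` A n) x)%:E)%E.
  apply: emeasurable_funM.
    by apply: measurableT_comp => //; exact: (measurable_int mu iw).
  by apply/measurable_EFinP; apply: measurable_indic; exact: measurableC.
have cW : \forall x \ae mu, setT x ->
    (fun n => `|(w x)%:E| * (\1_(~` A n) x)%:E)%E @ \oo --> (0 : \bar R)%E.
  apply: filterS pP => x px _.
  have [n0 Fx] : exists n, F n x.
    by have : setT x by []; rewrite FT => -[n _ Fx]; exists n.
  pose N := Num.truncn (\sum_i `|G i x|).
  apply: (@cvg_near_cst).
  exists (maxn n0 N.+1) => // n /=; rewrite geq_max => /andP[n0n Nn].
  rewrite indicE memNset ?mule0//= => /(_ _)[]; split.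
    by move: Fx; exact/subsetPset/Fnd.
  split => //= i _ /=.
  apply: (@le_trans _ _ (\sum_i `|G i x|)).
    by rewrite (bigD1 i)//= lerDl sumr_ge0.
  by rewrite ltW// (lt_le_trans (truncnS_gt _))// ler_nat.
have iaw : mu.-integrable setT (fun x => `|(w x)%:E|%E) by exact: integrable_abse.
have bW : \forall x \ae mu, forall n, setT x ->
    (`| `|(w x)%:E| * (\1_(~` A n) x)%:E | <= `|(w x)%:E|)%E.
  apply: aeW => x n _; rewrite abseM abse_id indicE.
  by case: (_ \in _); rewrite /= ?normr1 ?normr0 ?mule1 ?mule0.
have [_ _] := dominated_convergence measurableT mW (@measurable_cst _ _ _ _ _ _) cW iaw bW.
rewrite integral0 => /fine_cvgP[fW] /cvgrPdist_lt/(_ _ e0) cvW.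
have [n _ hn] := filterI fW cvW.
have [/= fn dn] := hn n (leqnn n).
exists (A n), n; split.
- exact: mA.
- have [mFn Fny] := Ffin n.
  by apply: le_lt_trans Fny; apply: le_measure; rewrite ?inE// => x [].
- by move=> x [_ [? _]].
- by move=> x i [_ [_ /(_ i Logic.I)]].
- rewrite integral_mkcond.
  have -> : (\int[mu]_x ((fun x => `|(w x)%:E|) \_ (~` A n)) x =
      \int[mu]_x (`|(w x)%:E| * (\1_(~` A n) x)%:E))%E.
    apply: eq_integral => x _; rewrite patchE indicE.
    by case: ifP; rewrite ?mule1 ?mule0.
  rewrite -(fineK fn) lee_fin; move: dn; rewrite sub0r normrN => dn.
  by rewrite ltW// (le_lt_trans (ler_norm _)).
Qed.

(** The order of the choices is [A], then the step [1/(j+1)] for the [G_i],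
    then [k]: the number of cells is at most a constant times [k], where the
    constant depends on [A] and [j] only, so the cells of measure less than
    [2^-k] have small total measure for [k] large. *)
Lemma good_cells (w v : T -> R) (e : R) :
  mu.-integrable setT (EFin \o w) ->
  (forall D, measurable D -> (mu D < +oo)%E -> mu.-integrable D (EFin \o v)) ->
  0 < e ->
  exists (C : finType) (E : C -> set T) (k : nat) (theta : R),
  let U := \big[setU/set0]_(c <- enum C) E c in
  [/\ [/\ (0 < k)%N, forall c, measurable (E c), trivIset setT E,
          forall c, (mu (E c) < +oo)%E & (mu U < +oo)%E],
      [/\ forall c, E c = set0 \/ ((2 ^- k)%:E <= mu (E c))%E,
          (\sum_c mu (E c) <= (2 ^+ k)%:E)%E,
          forall c x, E c x -> (p x <= P%:E)%E &
          forall c x y, E c x -> E c y -> `|fine (p x) - fine (p y)| * k%:R <= 1],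
      forall i c x y, E c x -> E c y -> `|G i x - G i y| <= theta,
      theta * (\int[mu]_(x in U) `|v x|) <= e &
      \int[mu]_(x in ~` U) `|w x| <= e].
Proof.
move=> iw iv e0.
have e20 : 0 < e / 2 by rewrite divr_gt0.
have [A [M [mA Ay pA GA wA]]] := bounded_exhaustion iw e20.
have [dl [dl0 hdl]] := integral_normr_continuous iw e20.
pose V := \int[mu]_(x in A) `|v x|.
have V0 : 0 <= V by exact: Rintegral_ge0.
pose j := Num.truncn (V / e).
have jV : j.+1%:R^-1 * V <= e.
  by rewrite mulrC ler_pdivrMr// mulrC -ler_pdivrMr// ltW// truncnS_gt.
pose P1 := (Num.truncn P).+1.
pose N1 := (2 * M * j.+1).+1.
pose N := #|{ffun I -> 'I_N1}|.
have fA : mu A \is a fin_num by rewrite ge0_fin_numE.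
have [k k0 hk] := exp2_dominates ((N * (2 * P1).+1)%:R / dl + fine (mu A) + 1).
have k1 : 1 <= k%:R :> R by rewrite ler1n.
have Nk0 : 0 <= (N * (2 * P1).+1)%:R / dl by rewrite divr_ge0 // ltW.
have muA0 : 0 <= fine (mu A) by rewrite fine_ge0.
have muA2k : (mu A <= (2 ^+ k)%:E)%E.
  by rewrite -(fineK fA) lee_fin; apply: le_trans hk; nra.
have Ndl : (N * (2 * P1 * k).+1)%:R * 2 ^- k < dl.
  rewrite ltr_pdivrMr ?exprn_gt0//.
  have h1 : (N * (2 * P1 * k).+1)%:R <= (N * (2 * P1).+1)%:R * k%:R :> R.
    rewrite -natrM ler_nat -(mulnA N) leq_mul2l; apply/orP; right.
    by rewrite mulSn -[(2 * P1 * k).+1]add1n leq_add2r.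
  apply: (le_lt_trans h1); rewrite -[(N * _)%:R](divfK (lt0r_neq0 dl0)).
  rewrite mulrAC mulrC ltr_pM2l//.
  by apply: lt_le_trans hk; rewrite !mulrDl; nra.
have mfp : measurable_fun setT (fun x => fine (p x)).
  exact: (measurableT_comp _ (measurable_vexp p)).
have [Sp [mSp dSp cSp oSp]] := level_sets P1 k.-1 mfp.
have /choice[S hS'] := fun i => level_sets M j (mG i).
pose C : finType := ({ffun I -> 'I_N1} * 'I_(2 * P1 * k.-1.+1).+1)%type.
pose E0 (c : C) := A `&` (\bigcap_(i in [set: I]) S i (c.1 i) `&` Sp c.2).
have mE0 c : measurable (E0 c).
  apply: measurableI => //; apply: measurableI => //.
  by apply: fin_bigcap_measurable => // i _; have [] := hS' i.
have E0A c : E0 c `<=` A by move=> x [].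
have dE0 c c' x : E0 c x -> E0 c' x -> c = c'.
  move=> [_ [h1 h2]] [_ [h1' h2']]; rewrite [c]surjective_pairing [c']surjective_pairing.
  congr pair; last exact: dSp h2 h2'.
  by apply/ffunP => i; have [_ dS _ _] := hS' i; exact: dS (h1 i Logic.I) (h1' i Logic.I).
pose big c := ((2 ^- k)%:E <= mu (E0 c))%E.
pose E c := if big c then E0 c else set0.
pose B := \big[setU/set0]_(c <- enum C) (if big c then set0 else E0 c).
have EE0 c : E c `<=` E0 c by move=> x; rewrite /E; case: ifP.
have mE c : measurable (E c) by rewrite /E; case: ifP => // _; exact: mE0.
have mF c : measurable (if big c then set0 else E0 c).
  by case: ifP => // _; exact: mE0.
have mB : measurable B by apply: bigsetU_measurable => c _; exact: mF.
have muB : (mu B < dl%:E)%E.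
  apply: (@le_lt_trans _ _ ((N * (2 * P1 * k).+1)%:R * 2 ^- k)%:E); last by rewrite lte_fin.
  apply: le_trans (measure_bigsetU_le _ _ mF) _.
  rewrite big_enum/=; apply: (@le_trans _ _ (\sum_(c : C) (2 ^- k)%:E)%E).
    apply: lee_sum => c _; case: ifPn => [_|]; first by rewrite measure0 lee_fin invr_ge0 exprn_ge0.
    by rewrite -ltNge => /ltW.
  by rewrite sumEFin sumr_const card_prod card_ord prednK// lee_fin -[leLHS]mulr_natl.
pose U := \big[setU/set0]_(c <- enum C) E c.
have tE : trivIset setT E.
  by move=> c c' _ _ [x [/EE0 h1 /EE0 h2]]; exact: dE0 h1 h2.
have UE : U = \bigcup_c E c by exact: bigsetU_enumE.
have UA : U `<=` A by rewrite UE => x [c _ /EE0]; exact: E0A.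
have mU : measurable U by exact: bigsetU_measurable.
have Uy : (mu U < +oo)%E by apply: le_lt_trans Ay; apply: le_measure; rewrite ?inE.
have CU : ~` U `<=` ~` A `|` B.
  move=> x nUx; have [Ax|] := pselect (A x); last by left.
  right; have [c Ec] : exists c, E0 c x.
    have pfin : 1 <= fine (p x) <= P.
      have := vexp_ge1 p x; have := pA x Ax.
      by case: (p x) => // r; rewrite !lee_fin /= => -> ->.
    have [cp hcp] : exists c, Sp c x.
      apply: cSp; case/andP: pfin => p1 p2 /=; rewrite ger0_norm; last lra.
      by rewrite (le_trans p2)// ltW// truncnS_gt.
    have /choice[ci hci] : forall i, exists c, S i c x.
      by move=> i; have [_ _ cS _] := hS' i; apply: cS; exact: GA.
    exists ([ffun i => ci i], cp); split => //; split => // i _ /=.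
    by rewrite ffunE.
  rewrite /B -bigcup_seq; exists c => /=; first by rewrite mem_enum.
  case: ifPn => // bc; apply: nUx; rewrite UE; exists c => //.
  by rewrite /E bc.
exists C, E, k, j.+1%:R^-1 => /=; split.
- split => // c; apply: le_lt_trans Ay; apply: le_measure; rewrite ?inE//.
  by move=> x /EE0/E0A.
- split.
  + by move=> c; rewrite /E; case: ifP => h; [right|left].
  + apply: le_trans muA2k.
    apply: (@le_trans _ _ (\sum_c \int[mu]_(x in E c) (\1_A x)%:E)%E).
      apply: lee_sum => c _; rewrite integral_indic//.
      by rewrite (setIidr _)// => x /EE0/E0A.
    rewrite -[leRHS](_ : \int[mu]_x (\1_A x)%:E = _)%E; last first.
      by rewrite integral_indic// setIT.
    apply: (@sum_integral_le _ _ _ mu C E mE tE (fun x => (\1_A x)%:E)).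
      exact/measurable_EFinP.
    by move=> x; rewrite lee_fin.
  + by move=> c x /EE0/E0A; exact: pA.
  + move=> c x y /EE0[_ [_ h1]] /EE0[_ [_ h2]].
    by have := oSp _ _ _ h1 h2; rewrite prednK.
- move=> i c x y /EE0[_ [h1 _]] /EE0[_ [h2 _]].
  have [_ _ _ oS] := hS' i.
  have := oS _ _ _ (h1 i Logic.I) (h2 i Logic.I); rewrite -ler_pdivlMr//.
  by rewrite div1r.
- apply: le_trans jV; apply: ler_wpM2l => //.
  rewrite /V -lee_fin !fineK; last 2 first.
  + by apply: integrable_fin_num => //; apply: integrable_norm; exact: iv.
  + by apply: integrable_fin_num => //; apply: integrable_norm; exact: iv.
  apply: ge0_subset_integral => //.
  by apply: (measurable_int mu); apply: integrable_norm; exact: iv.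
- have inw : mu.-integrable setT (EFin \o (fun x => `|w x|)) by exact: integrable_norm.
  have inwD D : measurable D -> mu.-integrable D (EFin \o (fun x => `|w x|)).
    by move=> mD; exact: integrableS inw.
  have mCU : measurable (~` U) by exact: measurableC.
  have mCA : measurable (~` A) by exact: measurableC.
  have BA : B `<=` A.
    by rewrite /B -bigcup_seq => x [c _]; case: ifP => // _; exact: E0A.
  apply: (@le_trans _ _ (\int[mu]_(x in ~` A `|` B) `|w x|)).
    rewrite -lee_fin !fineK; last 2 first.
    + by apply: integrable_fin_num => //; [exact: measurableU|apply: inwD; exact: measurableU].
    + by apply: integrable_fin_num => //; exact: inwD.
    apply: ge0_subset_integral => //; first exact: measurableU.
    by apply: (measurable_int mu); apply: inwD; exact: measurableU.
  rewrite Rintegral_setU//; last 2 first.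
  + by apply: inwD; exact: measurableU.
  + by rewrite disj_set_sym; exact/disj_setPCl.
  rewrite [leRHS](splitr e); apply: lerD.
    rewrite -lee_fin fineK//; apply: integrable_fin_num => //; exact: inwD.
  exact/ltW/hdl.
Qed.

End exhaust.
End cells_existence.

(** * The trace does not depend on the representation *)

Section trace.
Context {d} {T : measurableType d} {R : realType}.
Variables (mu : {sigma_finite_measure set T -> \bar R}).
Variables (p : vexponent T R).

(** A finite family of pairs is approximated at once by taking for [w] and [v]
    the sums of [|f_i h_i|] and of [|h_i|]. *)
Lemma avg_form_cells (P : R) (pP : \forall x \ae mu, (p x <= P%:E)%E) (I : finType)
    (f : I -> vLspace mu p) (h : I -> vLspace mu (vexp_conj p)) (e : R) : 0 < e ->
  exists (C : finType) (E : C -> set T),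
  [/\ forall c, measurable (E c), forall c, (mu (E c) < +oo)%E,
      forall i, `|avg_form mu E (f i) (h i) - lp_pairing (f i) (h i)| <= e &
      forall (f : vLspace mu p) (h : vLspace mu (vexp_conj p)),
        `|avg_form mu E f h| <= (3 + 8 * 2 `^ P) * (`|f| * `|h|)].
Proof.
move=> e0; have e20 : 0 < e / 2 by rewrite divr_gt0.
pose w x := \sum_i `|f i x * h i x|.
pose v x := \sum_i `|h i x|.
have isum D (F : I -> T -> R) : measurable D ->
    (forall i, mu.-integrable D (EFin \o F i)) ->
    mu.-integrable D (EFin \o (fun x => \sum_i `|F i x|)).
  move=> mD iF.
  have := @integrable_sum _ _ _ mu D mD I (index_enum I) xpredT
    (fun i x => `|F i x|%:E) (fun i _ => integrable_norm (iF i)).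
  by apply: eq_integrable => // x _; rewrite /= sumEFin.
have iw : mu.-integrable setT (EFin \o w).
  by apply: isum => // i; exact: vL_mul_integrable.
have iv D : measurable D -> (mu D < +oo)%E -> mu.-integrable D (EFin \o v).
  by move=> mD Dy; apply: isum => // i; exact: vL_integrable_on.
have mG i : measurable_fun setT (f i) by exact: vL_measurable.
have [C [E [k [theta [[k0 mE tE Ey Uy] [Ebig Esum pE posc] osc Uv Uw]]]]] :=
  good_cells pP mG iw iv e20.
exists C, E; split => // [i|f0 h0]; last exact: (@avg_form_le _ _ _ _ _ _ mE tE p k).
set U := (X in \int[mu]_(x in X) `|v x|) in Uv Uw.
have mU : measurable U by exact: bigsetU_measurable.
have mCU : measurable (~` U) by exact: measurableC.
(* nothing is known on the sign of [theta] when all cells are empty *)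
have theta0 : (0 <= theta) \/ U = set0.
  have [[c [x Ecx]]|nE] := pselect (exists c x, E c x).
    by left; apply: le_trans (osc i c x x Ecx Ecx).
  right; rewrite /U bigsetU_enumE//; apply/seteqP; split => // x [c _ Ecx].
  by apply: nE; exists c, x.
have wi x : `|f i x * h i x| <= `|w x|.
  rewrite [leRHS]ger0_norm ?sumr_ge0// /w (bigD1 i)//= lerDl.
  exact: sumr_ge0.
have vi x : `|h i x| <= `|v x|.
  rewrite [leRHS]ger0_norm ?sumr_ge0// /v (bigD1 i)//= lerDl.
  exact: sumr_ge0.
have ihU : mu.-integrable U (EFin \o h i) by exact: vL_integrable_on.
apply: (le_trans (avg_form_approx mE tE Ey (fun c => vL_integrable_on _ (mE c) (Ey c))
  ihU (vL_mul_integrable (f i) (h i)) (osc i))).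
rewrite -/U [leRHS](splitr e); apply: lerD.
  apply: le_trans Uv; have [t0|->] := theta0; last by rewrite !Rintegral_set0.
  apply: ler_wpM2l => //; apply: le_Rintegral => //.
  - exact: integrable_norm.
  - by apply: integrable_norm; exact: iv.
apply: le_trans Uw; apply: le_Rintegral => //.
- apply: integrable_norm; apply: integrableS (vL_mul_integrable (f i) (h i)) => //.
- by apply: integrable_norm; apply: integrableS iw.
Qed.

Lemma lp_pairing_indicr (D : set T) (f : vLspace mu p) (e : vLspace mu (vexp_conj p)) :
  measurable D -> (e : T -> R) = \1_D %[ae mu] ->
  lp_pairing f e = \int[mu]_(x in D) f x.
Proof.
move=> mD eD; rewrite Rintegral_mkcond; apply: ae_eq_Rintegral.
- exact: vL_mul_measurable.
- by apply/(measurable_restrictT _ mD)/measurable_funTS; exact: vL_measurable.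
apply: filterS eD => x h xT; rewrite h// patchE indicE.
by case: (x \in D); rewrite ?mulr1 ?mulr0.
Qed.

Lemma lp_pairing_indicl (D : set T) (e : vLspace mu p) (h : vLspace mu (vexp_conj p)) :
  measurable D -> (e : T -> R) = \1_D %[ae mu] ->
  lp_pairing e h = \int[mu]_(x in D) h x.
Proof.
move=> mD eD; rewrite Rintegral_mkcond; apply: ae_eq_Rintegral.
- exact: vL_mul_measurable.
- by apply/(measurable_restrictT _ mD)/measurable_funTS; exact: vL_measurable.
apply: filterS eD => x eDx xT; rewrite eDx// patchE indicE.
by case: (x \in D); rewrite ?mul1r ?mul0r.
Qed.

(** The number [tau] is the trace of [A] followed by averaging over the cells;
    pairings are continuous, so it can be computed from any representation. *)
Lemma avg_form_trace (C : finType) (E : C -> set T) (A : vLspace mu p -> vLspace mu p) :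
  (forall c, measurable (E c)) -> (forall c, (mu (E c) < +oo)%E) ->
  exists tau : R, forall (g : nat -> vLspace mu p) (h : nat -> vLspace mu (vexp_conj p)),
    (forall f, series (fun n => lp_pairing f (h n) *: g n) @ \oo --> A f) ->
    series (fun n => avg_form mu E (g n) (h n)) @ \oo --> tau.
Proof.
move=> mE Ey.
have /choice[u uE] := fun c => vL_indic_ex p (mE c) (Ey c).
have /choice[u' uE'] := fun c => vL_indic_ex (vexp_conj p) (mE c) (Ey c).
exists (\sum_c (fine (mu (E c)))^-1 * lp_pairing (A (u c)) (u' c)) => g h Agh.
rewrite (_ : series _ = (fun n => \sum_c (fine (mu (E c)))^-1 *
    lp_pairing (series (fun i => lp_pairing (u c) (h i) *: g i) n) (u' c))).
  apply: cvg_big; [exact: add_continuous|move=> c _].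
  apply: cvgM; first exact: cvg_cst.
  by apply: cvg_lp_pairing; exact: Agh.
apply/funext => n; rewrite {1}/series/= /avg_form exchange_big/=.
apply: eq_bigr => c _; rewrite lp_pairing_series /series/= mulr_sumr.
apply: eq_bigr => i _.
rewrite (lp_pairing_indicr _ (mE c) (uE' c)) (lp_pairing_indicl _ (mE c) (uE c)).
ring.
Qed.

(** The first [N] terms are close by assumption; for the others, [B] and the
    pairing are both bounded by the product of the norms. *)
Lemma trace_approx (g : nat -> vLspace mu p) (h : nat -> vLspace mu (vexp_conj p))
    (B : vLspace mu p -> vLspace mu (vexp_conj p) -> R) (K delta eta t tau : R) (N : nat) :
  (forall f h, `|B f h| <= K * (`|f| * `|h|)) -> 0 <= K ->
  (forall i, (i < N)%N -> `|B (g i) (h i) - lp_pairing (g i) (h i)| <= delta) ->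
  (forall n, (N <= n)%N -> \sum_(N <= i < n) `|g i| * `|h i| <= eta) ->
  series (fun n => lp_pairing (g n) (h n)) @ \oo --> t ->
  series (fun n => B (g n) (h n)) @ \oo --> tau ->
  `|tau - t| <= N%:R * delta + (K + 2) * eta.
Proof.
move=> BK K0 Bd tail ct ctau.
have c : (fun n => `|series (fun n => B (g n) (h n)) n -
    series (fun n => lp_pairing (g n) (h n)) n|) @ \oo --> `|tau - t|.
  by apply: cvg_norm; exact: cvgB.
apply: (cvgr_to_le c).
exists N => // n /= Nn.
rewrite /series/= -sumrB (@big_cat_nat _ _ _ N)//=.
apply: (le_trans (ler_normD _ _)); apply: lerD.
  apply: (le_trans (ler_norm_sum _ _ _)).
  apply: (@le_trans _ _ (\sum_(0 <= i < N) delta)).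
    by apply: ler_sum_nat => i /andP[_]; exact: Bd.
  by rewrite sumr_const_nat subn0 mulr_natl.
apply: (le_trans (ler_norm_sum _ _ _)).
apply: (@le_trans _ _ (\sum_(N <= i < n) (K + 2) * (`|g i| * `|h i|))).
  apply: ler_sum => i _; apply: (le_trans (ler_normB _ _)); rewrite mulrDl.
  by apply: lerD; [exact: BK|exact: lp_pairing_le].
by rewrite -mulr_sumr ler_wpM2l ?tail// addr_ge0.
Qed.

(** The cells are chosen for the first [N] terms of both representations
    simultaneously, hence the index type [bool * 'I_N]; then both sums are
    within [e / 2] of the same number [tau]. *)
Lemma trace_unique (A : vLspace mu p -> vLspace mu p)
    (g g' : nat -> vLspace mu p) (h h' : nat -> vLspace mu (vexp_conj p)) (t t' : R) :
  (ess_sup mu p < +oo)%E ->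
  cvgn (series (fun n => `|g n| * `|h n|)) ->
  cvgn (series (fun n => `|g' n| * `|h' n|)) ->
  (forall f, series (fun n => lp_pairing f (h n) *: g n) @ \oo --> A f) ->
  (forall f, series (fun n => lp_pairing f (h' n) *: g' n) @ \oo --> A f) ->
  series (fun n => lp_pairing (g n) (h n)) @ \oo --> t ->
  series (fun n => lp_pairing (g' n) (h' n)) @ \oo --> t' -> t = t'.
Proof.
move=> py gh gh' Agh Agh' ct ct'.
have pP : \forall x \ae mu, (p x <= (fine (ess_sup mu p))%:E)%E.
  apply: filterS (ess_sup_ge mu p) => x /le_trans; apply.
  by case: (ess_sup mu p) py => //= _; rewrite leNye.
set P := fine _ in pP.
pose K := 3 + 8 * 2 `^ P.
have K0 : 0 <= K by rewrite addr_ge0// mulr_ge0// powR_ge0.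
apply/eqP; rewrite -subr_eq0 -normr_le0; apply/ler_addgt0Pr => e e0; rewrite add0r.
pose eta := e / 4 / (K + 2).
have eta0 : 0 < eta by rewrite !divr_gt0// ltr_wpDl.
have [N1 tail1] := series_tail_small gh eta0.
have [N2 tail2] := series_tail_small gh' eta0.
pose N := maxn N1 N2.
have tail (a : nat -> R) M : (forall i, 0 <= a i) -> (M <= N)%N ->
    (forall n, (M <= n)%N -> \sum_(M <= i < n) a i <= eta) ->
    forall n, (N <= n)%N -> \sum_(N <= i < n) a i <= eta.
  move=> a0 MN h0 n Nn; apply: le_trans (h0 n (leq_trans MN Nn)).
  by rewrite [leRHS](@big_cat_nat _ _ _ N)//= lerDr sumr_ge0.
pose delta := e / 4 / N.+1%:R.
have delta0 : 0 < delta by rewrite !divr_gt0.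
have [C [E [mE Ey approx bound]]] := @avg_form_cells P pP (bool * 'I_N)%type
  (fun bi => if bi.1 then g bi.2 else g' bi.2)
  (fun bi => if bi.1 then h bi.2 else h' bi.2) delta delta0.
have [tau htau] := avg_form_trace A mE Ey.
have hN : N%:R * delta + (K + 2) * eta <= e / 2.
  have h1 : N%:R * delta <= e / 4.
    rewrite /delta mulrCA ler_piMr ?divr_ge0 ?ltW//.
    by rewrite ltr_pdivrMr// mul1r ltr_nat.
  have h2 : (K + 2) * eta = e / 4.
    by rewrite /eta mulrCA divff ?mulr1// gt_eqF// ltr_wpDl.
  by rewrite h2; lra.
have h1 : `|tau - t| <= e / 2.
  apply: le_trans hN; apply: (@trace_approx g h (fun f h => avg_form mu E f h)) => //.
  - by move=> i iN; exact: (approx (true, Ordinal iN)).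
  - by apply: tail tail1 => //; exact: leq_maxl.
  - exact: htau.
have h2 : `|tau - t'| <= e / 2.
  apply: le_trans hN; apply: (@trace_approx g' h' (fun f h => avg_form mu E f h)) => //.
  - by move=> i iN; exact: (approx (false, Ordinal iN)).
  - by apply: tail tail2 => //; exact: leq_maxr.
  - exact: htau.
rewrite (_ : t - t' = (tau - t') - (tau - t)); last by ring.
by apply: le_trans (ler_normB _ _) _; lra.
Qed.

End trace.

(** * Characterization of nuclear operators and the trace formula *)

Theorem theorem3p5 (R : realType) (r : R) (r_gt0 : 0 < r) (r_le1 : r <= 1)
    (d d' : measure_display) (Omega : measurableType d) (Xi : measurableType d')
    (mu : {sigma_finite_measure set Omega -> \bar R})
    (nu : {sigma_finite_measure set Xi -> \bar R})
    (mu_complete : measure_is_complete mu)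
    (nu_complete : measure_is_complete nu)
    (p : vexponent Omega R) (q : vexponent Xi R) :
  (forall T : vLspace mu p -> vLspace nu q,
     nuclear (@lp_pairing d Omega R mu p) r T <->
     exists (g : nat -> vLspace nu q) (h : nat -> vLspace mu (vexp_conj p)),
       summable_pow r g h /\ kernel_rep T g h)
  /\
  ((ess_sup mu p < +oo)%E ->
   forall T : vLspace mu p -> vLspace mu p,
     bounded_operator T -> nuclear (@lp_pairing d Omega R mu p) r T ->
   forall (g : nat -> vLspace mu p) (h : nat -> vLspace mu (vexp_conj p)),
     summable_pow r g h -> kernel_rep T g h ->
     [/\ series (fun n => lp_pairing (g n) (h n)) @ \oo -->
           nuclear_trace (@lp_pairing d Omega R mu p) T,
         \forall x \ae mu, cvgn (series (fun n => g n x * h n x)),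
         mu.-integrable [set: Omega] (fun x => (kernel_sum g h x x)%:E) &
         nuclear_trace (@lp_pairing d Omega R mu p) T =
           \int[mu]_x kernel_sum g h x x]).
Proof.
split=> [T|py T _ _ g h gh_r Tgh].
  split=> [[linT [h [g [Tf hg]]]]|[g [h [gh Tgh]]]].
    have gh := summable_powC hg.
    exists g, h; split => //.
    exact: (kernel_rep_series mu_complete (summable_powW r_gt0 r_le1 gh)).
  have cgh := summable_powW r_gt0 r_le1 gh.
  have Tf f : series (fun n => lp_pairing f (h n) *: g n) @ \oo --> T f.
    exact: series_kernel_rep.
  split; first exact: linear_series Tf.
  by exists h, g; split; [exact: Tf|exact: summable_powC].
have cgh := summable_powW r_gt0 r_le1 gh_r.
have Tf f : series (fun n => lp_pairing f (h n) *: g n) @ \oo --> T f.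
  exact: series_kernel_rep.
have [cx ik ck] := kernel_diagonal mu_complete cgh.
suff -> : nuclear_trace (@lp_pairing d Omega R mu p) T = \int[mu]_x kernel_sum g h x x.
  by split.
pose S := [set t : R | exists (x' : nat -> vLspace mu (vexp_conj p)) (y : nat -> vLspace mu p),
    nuclear_rep (@lp_pairing d Omega R mu p) 1 T x' y /\
    series (fun n => lp_pairing (y n) (x' n)) @ \oo --> t].
have Sgh : S (\int[mu]_x kernel_sum g h x x).
  exists h, g; split; last exact: ck.
  by split; [exact: Tf|exact/summable_powC/summable_pow1].
have : S (nuclear_trace (@lp_pairing d Omega R mu p) T) by exact: (xgetPex 0 (ex_intro S _ Sgh)).
move=> [x' [y [[Ty sy] cy]]].
have cyx := summable_powW ltr01 (lexx 1) (summable_powC sy).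
exact: (trace_unique py cyx cgh Ty Tf cy ck).
Qed.
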